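(* Let $n\ge 2$, $N\ge 1$, let $\Omega\subset\mathbb{R}^n$ be a bounded open set, and let $f:\Omega\times\mathbb{R}^{N\times n}\to\mathbb{R}$ be such that $x\mapsto f(x,z)$ is measurable for every $z$. Assume that there exist constants $K_1\ge 1$, $K_2,K_3\ge 0$, $\sigma>0$, $1<p<q$ such that: (F1) $q\le p\left(1+\frac{\sigma}{n}\right)$; (F2) $|z|^p\le f(x,z)\le K_1 f(\tilde x,z)+K_2|x-\tilde x|^{\sigma}|z|^q+K_3$ for every $x,\tilde x\in\Omega$ and every $z\in\mathbb{R}^{N\times n}$; (F3) for every $x\in\Omega$, the function $z\mapsto f(x,z)$ is convex; (F4) for every $x\in\Omega$ and every $\varepsilon>0$ with $\overline{B(x,\varepsilon)}\subset\Omega$, there exists $y^*\in\overline{B(x,\varepsilon)}$ such that $f(y^*,z)\le f(y,z)$ for all $y\in\overline{B(x,\varepsilon)}$ and all $z\in\mathbb{R}^{N\times n}$. Let $u\in W^{1,p}_{loc}(\Omega;\mathbb{R}^N)$ be such that $x\mapsto f(x,Du(x))$ belongs to $L^1_{loc}(\Omega)$, and let $u_\varepsilon$ be the standard mollification of $u$. Then, for every open ball $B=B(x^*,\rho)$ with $\overline{B}\subset\Omega$, as $\varepsilon\to 0^+$ we have $$u_\varepsilon\to u\ \text{ in } W^{1,p}(B;\mathbb{R}^N)\qquad\text{and}\qquad \int_B f(x,Du_\varepsilon(x))\,dx\to\int_B f(x,Du(x))\,dx.$$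
   Context: $B(x,\varepsilon)$ is the open ball in $\mathbb{R}^n$ with center $x$ and radius $\varepsilon$; $|z|$ is the Euclidean norm on $\mathbb{R}^{N\times n}$. Standard mollification: let $\phi\in C_c^\infty(\mathbb{R}^n)$ be the standard (nonnegative, radially symmetric) mollification kernel, supported in $\overline{B(0,1)}$ with $\int\phi=1$, and $\phi_\varepsilon(t)=\varepsilon^{-n}\phi(t/\varepsilon)$; then $u_\varepsilon(x)=\int_{B(x,\varepsilon)}u(y)\phi_\varepsilon(x-y)\,dy$, which is well defined for $x\in B$ whenever $\varepsilon>0$ is small enough (depending on $B$ and $\Omega$). *)

(* Defs.v *)
From HB Require Import structures.
From mathcomp Require Import all_boot all_order all_algebra.
From mathcomp Require Import all_classical all_reals all_analysis.

Set Implicit Arguments.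
Unset Strict Implicit.
Unset Printing Implicit Defensive.

Import Order.TTheory GRing.Theory Num.Theory.
Import numFieldNormedType.Exports.

Local Open Scope classical_set_scope.
Local Open Scope ring_scope.

(* The norm `|A| provided by the library on matrices is the sup norm. *)
Definition enorm (R : realType) (m k : nat) (A : 'M[R]_(m, k)) : R :=
  Num.sqrt (\sum_i \sum_j A i j ^+ 2).

Definition eball (R : realType) (n : nat) (x : 'rV[R]_n) (r : R)
  : set 'rV[R]_n := [set y | enorm (y - x) < r].

(* n-dimensional Lebesgue outer measure by countable covers with boxes.
   A member [None] of a cover is the empty set: the empty set is thus covered
   at no cost also in dimension 0, where a box is never empty. *)
Section lebesgue_outer_measure.
Context (R : realType) (n : nat).
Implicit Types (A : set 'rV[R]_n) (b : option ('rV[R]_n * 'rV[R]_n)).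

Definition box b : set 'rV[R]_n :=
  if b is Some c then [set x | forall i, c.1 0 i < x 0 i <= c.2 0 i] else set0.

Definition box_volume b : R :=
  if b is Some c then \prod_(i < n) Num.max 0 (c.2 0 i - c.1 0 i) else 0.

Definition box_cover A : set (nat -> option ('rV[R]_n * 'rV[R]_n)) :=
  [set Q | A `<=` \bigcup_k box (Q k)].

Definition leb_outer A : \bar R :=
  ereal_inf [set (\sum_(k <oo) (box_volume (Q k))%:E)%E | Q in box_cover A].

Local Open Scope ereal_scope.

Let vol b : \bar R := (box_volume b)%:E.

Let vol_ge0 b : 0 <= vol b.
Proof.
rewrite lee_fin; case: b => //= c.
by apply: prodr_ge0 => i _; rewrite le_max lexx.
Qed.

Let leb_outer_ge0 A : 0 <= leb_outer A.
Proof.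
apply: le_ereal_inf_tmp => x [Q _ <-{x}].
by apply: nneseries_ge0 => k _ _; exact: vol_ge0.
Qed.

Let leb_outer0 : leb_outer set0 = 0.
Proof.
apply/eqP; rewrite eq_le leb_outer_ge0 andbT.
apply: ereal_inf_lbound; exists (fun=> None); first by move=> ? [].
by rewrite eseries0.
Qed.

Let le_leb_outer : {homo leb_outer : A B / A `<=` B >-> A <= B}.
Proof.
move=> A B AB; apply/ereal_inf_le_tmp => x [Q BQ <-{x}].
by exists Q => //; exact: subset_trans AB BQ.
Qed.

Let leb_outer_sigma_subadditive : sigma_subadditive leb_outer.
Proof.
move=> A; have [[i ioo]|] := pselect (exists i, leb_outer (A i) = +oo).
  rewrite (eseries_pinfty _ _ ioo) ?leey// => k _.
  by rewrite -ltNye (lt_le_trans _ (leb_outer_ge0 _)).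
rewrite -forallNE => Aoo.
suff add2e (e : {posnum R}) :
    leb_outer (\bigcup_k A k) <= \sum_(i <oo) leb_outer (A i) + e%:num%:E.
  by apply/lee_addgt0Pr => _/posnumP[].
rewrite (le_trans _ (epsilon_trick _ _ _))//.
pose P k Q := box_cover (A k) Q /\
  \sum_(j <oo) vol (Q j) <= leb_outer (A k) + (e%:num / (2 ^ k.+1)%:R)%:E.
have [G PG] : {G & forall k, P k (G k)}.
  apply: (@choice _ _ P) => k; rewrite /P.
  have fA : leb_outer (A k) \is a fin_num.
    by rewrite ge0_fin_numE// ltey; exact/eqP/Aoo.
  have e0 : (0 < e%:num / (2 ^ k.+1)%:R)%R by [].
  have [x [Q AQ <-] Qlt] := lb_ereal_inf_adherent e0 fA.
  by exists Q; split=> //; exact/ltW.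
have volG_ge0 x : 0 <= (vol \o uncurry G) x by exact: vol_ge0.
apply: (@le_trans _ _ (\esum_(i in setT) (vol \o uncurry G) i)).
  apply: ereal_inf_lbound => /=.
  have /card_esym/ppcard_eqP[f] := card_nat2.
  exists (uncurry G \o f).
    move=> t [i _ /(PG i).1[j _ Gt]].
    by exists (f^-1%FUN (i, j)) => //=; rewrite invK ?inE.
  rewrite -(esum_pred_image (vol \o uncurry G) _ xpredT) ?[fun=> _]set_true//.
  by rewrite image_eq.
rewrite (_ : esum _ _ = \sum_(i <oo) \sum_(j <oo ) vol (G i j)); last first.
  pose J : nat -> set (nat * nat) := fun i => [set (i, j) | j in setT].
  rewrite (_ : setT = \bigcup_k J k); last first.
    by rewrite predeqE => -[a b]; split => // _; exists a => //; exists b.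
  rewrite esum_bigcupT /=; last 2 first.
    - apply/trivIsetP => i j _ _ ij.
      rewrite predeqE => -[k m] /=; split => //= -[] [_] _ [<-{k} _].
      by move=> [m' _] [] /esym/eqP; rewrite (negbTE ij).
    - by move=> /= [k m]; exact: vol_ge0.
  rewrite -(image_id [set: nat]) -fun_true esum_pred_image//; last first.
    by move=> k _; exact: esum_ge0.
  apply: eq_eseriesr => /= j _.
  rewrite -(esum_pred_image (vol \o uncurry G) (pair j) predT)//=; last first.
    by move=> ? ? _ _; exact: (@can_inj _ _ _ snd).
  by congr esum; rewrite predeqE => -[a b]; split; move=> [i _ <-]; exists i.
apply: lee_lim.
- apply: is_cvg_nneseries => k *.
  by apply: nneseries_ge0 => m *; exact: (volG_ge0 (k, m)).
- by apply: is_cvg_nneseries => k *; apply: adde_ge0.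
- by near=> k; apply: lee_sum => i _; exact: (PG i).2.
Unshelve. all: by end_near. Qed.

HB.instance Definition _ := isOuterMeasure.Build R 'rV[R]_n leb_outer
  leb_outer0 leb_outer_ge0 le_leb_outer leb_outer_sigma_subadditive.

End lebesgue_outer_measure.
Arguments leb_outer : clear implicits.

(* R^n with the (complete) sigma-algebra of Lebesgue measurable sets *)
Notation lebType R n := (caratheodory_type (leb_outer R n)).

Definition leb (R : realType) (n : nat) : set (lebType R n) -> \bar R :=
  leb_outer R n.

HB.instance Definition _ (R : realType) (n : nat) :=
  isMeasure.Build _ (lebType R n) R (@leb R n)
    (@caratheodory_measure0 _ _ (leb_outer R n))
    (@caratheodory_measure_ge0 _ _ (leb_outer R n))
    (@caratheodory_measure_sigma_additive _ _ (leb_outer R n)).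
Arguments leb : clear implicits.

Section function_spaces.
Context (R : realType) (n : nat).
Implicit Types (D O : set 'rV[R]_n) (p : R) (phi : 'rV[R]_n -> R).

Definition Lnorm_on (m k : nat) p D (g : 'rV[R]_n -> 'M[R]_(m, k)) : \bar R :=
  Lnorm (leb R n) p%:E ((fun x => (enorm (g x))%:E) \_ D).

Definition Lp (m k : nat) p D (g : 'rV[R]_n -> 'M[R]_(m, k)) : Prop :=
  (forall i j, measurable_fun (D : set (lebType R n)) (fun x => g x i j)) /\
  (Lnorm_on p D g < +oo)%E.

Definition Lp_loc (m k : nat) p O (g : 'rV[R]_n -> 'M[R]_(m, k)) : Prop :=
  forall K, compact K -> K `<=` O -> Lp p K g.

Definition L1_loc O (g : 'rV[R]_n -> R) : Prop :=
  forall K, compact K -> K `<=` O -> (leb R n).-integrable K (EFin \o g).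

Definition partial (j : 'I_n) phi : 'rV[R]_n -> R := 'D_(delta_mx 0 j) phi.

Definition smooth phi : Prop := forall s : seq 'I_n,
  continuous (foldr partial phi s) /\
  forall (j : 'I_n) x, derivable (foldr partial phi s) x (delta_mx 0 j).

Definition supp phi : set 'rV[R]_n := closure [set x | phi x != 0].

Definition test_function O phi : Prop :=
  [/\ smooth phi, compact (supp phi) & supp phi `<=` O].

Definition weak_gradient (N : nat) O
    (u : 'rV[R]_n -> 'rV[R]_N) (Du : 'rV[R]_n -> 'M[R]_(N, n)) : Prop :=
  [/\ forall i, L1_loc O (fun x => u x 0 i),
      forall i j, L1_loc O (fun x => Du x i j) &
      forall phi, test_function O phi -> forall i j,
        (\int[leb R n]_(x in O) (u x 0 i * partial j phi x)%:E =
         - \int[leb R n]_(x in O) (Du x i j * phi x)%:E)%E].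

(* A Sobolev function is represented together with (a version of) its weak
   gradient. *)
Definition W1p (N : nat) p O
    (u : 'rV[R]_n -> 'rV[R]_N) (Du : 'rV[R]_n -> 'M[R]_(N, n)) : Prop :=
  [/\ weak_gradient O u Du, Lp p O u & Lp p O Du].

Definition W1p_loc (N : nat) p O
    (u : 'rV[R]_n -> 'rV[R]_N) (Du : 'rV[R]_n -> 'M[R]_(N, n)) : Prop :=
  [/\ weak_gradient O u Du, Lp_loc p O u & Lp_loc p O Du].

Definition W1p_norm (N : nat) p O
    (u : 'rV[R]_n -> 'rV[R]_N) (Du : 'rV[R]_n -> 'M[R]_(N, n)) : \bar R :=
  (Lnorm_on p O u + Lnorm_on p O Du)%E.

(* Convergence in W^{1,p}(O) as e -> 0+; membership is only required for
   all small e. *)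
Definition cvg_W1p (N : nat) p O
    (v : R -> 'rV[R]_n -> 'rV[R]_N) (Dv : R -> 'rV[R]_n -> 'M[R]_(N, n))
    (u : 'rV[R]_n -> 'rV[R]_N) (Du : 'rV[R]_n -> 'M[R]_(N, n)) : Prop :=
  [/\ \forall e \near 0^'+, W1p p O (v e) (Dv e),
      W1p p O u Du &
      W1p_norm p O (fun x => v e x - u x) (fun x => Dv e x - Du x)
        @[e --> 0^'+] --> 0%E].

Definition grad (N : nat) (u : 'rV[R]_n -> 'rV[R]_N) (x : 'rV[R]_n)
  : 'M[R]_(N, n) := \matrix_(i, j) partial j (fun y => u y 0 i) x.

Definition mollification_kernel phi : Prop :=
  [/\ smooth phi,
      supp phi `<=` closure (eball 0 1),
      forall x, 0 <= phi x,
      forall x y, enorm x = enorm y -> phi x = phi y &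
      (\int[leb R n]_x (phi x)%:E = 1)%E].

Definition mollify (N : nat) phi (u : 'rV[R]_n -> 'rV[R]_N) (e : R)
    (x : 'rV[R]_n) : 'rV[R]_N :=
  \row_i (\int[leb R n]_(y in eball x e)
            (u y 0 i * (e ^- n * phi (e^-1 *: (x - y))))).

End function_spaces.

(* Main.v *)
Require Import Defs.
From HB Require Import structures.
From mathcomp Require Import all_boot all_order all_algebra.
From mathcomp Require Import all_classical all_reals all_analysis.
From mathcomp Require Import measurable_realfun ring lra.

(* Write [F x := f x (Du x)], [K_e] for convolution with [phi_e], so that
   [D(K_e u) = K_e Du] at distance [> e] from the boundary. If [y'] minimizes
   [f . z] over the closed [e]-ball around [x] for all [z] at once (F4), Jensen
   gives [f y' (K_e Du x) <= K_e (f y' (Du .)) x <= K_e F x]. In particular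
   [|K_e Du x|^p <= K_e F x <= C e^-n], and (F1) turns this into
   [e^sigma |K_e Du x|^q <= C' K_e F x]; hence, by (F2) applied to [x] and [y'],
   [f x (K_e Du x) <= C'' K_e F x + K3]. Since [K_e F -> F] in [L^1], dominated
   convergence along fast sequences [e_k -> 0] gives the convergence of the
   energies, and likewise of [|K_e Du - Du|^p] and [|K_e u - u|^p].

   Jensen's inequality rests on affine minorants of finite convex functions, and
   [K_e h -> h] in [L^1] on the density of indicators of open sets of finite
   measure. *)

Import Order.TTheory GRing.Theory Num.Theory.
Import numFieldNormedType.Exports.

Set Implicit Arguments.
Unset Strict Implicit.
Unset Printing Implicit Defensive.

Local Open Scope classical_set_scope.
Local Open Scope ring_scope.

(** * Lebesgue measure *)

(** [u], [Du] and the energy are integrable only on compact subsets of [Omega], while Tonelli's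
    theorem and translation invariance are used on the whole space. All three are therefore extended
    by zero from one compact [K] inside [Omega] that contains every ball of radius at most [d]
    centred in [B]; for [e <= d] the cut-off is invisible from [B]. Jensen's inequality concerns a
    single convex function, so the base point has to be frozen while the argument [Du y] varies:
    this is why the minimizer of (F4) must serve all [z] at once. The bound [C e^-n] is the supremum
    of the kernel times the [L^1] norm of the energy. Convergence of [K_e F] in [L^1] provides
    neither pointwise convergence nor a majorant; along a sequence whose distances are summable it
    provides both. For [u] itself no energy is available, and a convex sum of powers of the entries
    takes its place. Measurability of [f x (V x)] is an issue of its own, since [f] is measurable in
    [x] only for fixed [z]: convexity supplies the continuity in [z] that a Caratheodory argument
    needs. *)

Lemma box_volume_ge0 {R : realType} {n : nat}
  (b : option ('rV[R]_n * 'rV[R]_n)) : 0 <= box_volume b.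
Proof.
case: b => //= c; by apply: prodr_ge0 => i _; rewrite le_max lexx.
Qed.

Lemma leb_le_cover {R : realType} {n : nat} (A : set (lebType R n)) Q : box_cover A Q ->
  (leb R n A <= \sum_(k <oo) (box_volume (Q k))%:E)%E.
Proof. by move=> AQ; apply: ereal_inf_lbound; exists Q. Qed.

Lemma leb_le_box {R : realType} {n : nat} (A : set (lebType R n)) b : A `<=` box b ->
  (leb R n A <= (box_volume b)%:E)%E.
Proof.
move=> Ab; pose Q (k : nat) : option ('rV[R]_n * 'rV[R]_n) := if k is 0%N then b else None.
have AQ : box_cover A Q by move=> x /Ab bx; exists 0%N.
apply: (le_trans (leb_le_cover AQ)).
rewrite (nneseries_split 0 1)//; last by move=> k _; rewrite lee_fin box_volume_ge0.
rewrite add0n eseries0 ?adde0.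
  by rewrite big_mkord big_ord_recl big_ord0 adde0.
by move=> [|k].
Qed.

Definition set_coord {R : realType} {n : nat} (v : 'rV[R]_n) (i : 'I_n) (a : R) : 'rV[R]_n :=
  \row_j if j == i then a else v 0 j.

(** The hyperplane cuts each box of a cover into two boxes whose volumes add up, and the two
    resulting families cover the two parts of the test set; Caratheodory's condition asks for no
    more. *)
Lemma halfspace_measurable {R : realType} {n : nat} (i : 'I_n) (a : R) :
  measurable ([set x : 'rV[R]_n | x 0 i <= a] : set (lebType R n)).
Proof.
apply: le_caratheodory_measurable => X /=.
apply: le_ereal_inf_tmp => _ [Q XQ <-].
(* Clamping one corner cuts the box at height [a]. If the box lies on one side, the other piece has
   a nonpositive edge and [Num.max 0] gives it volume 0. *)
pose Q1 k := if Q k is Some c then Some (c.1, set_coord c.2 i (Num.min (c.2 0 i) a)) else None.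
pose Q2 k := if Q k is Some c then Some (set_coord c.1 i (Num.max (c.1 0 i) a), c.2) else None.
have volE k : box_volume (Q k) = box_volume (Q1 k) + box_volume (Q2 k).
  rewrite /Q1 /Q2; case: (Q k) => [c|] /=; last by rewrite addr0.
  have prodE (F : 'I_n -> R) : \prod_j F j = F i * \prod_(j | j != i) F j by rewrite (bigD1 i).
  rewrite !prodE !mxE eqxx.
  have same (d1 d2 : 'rV[R]_n) : (forall j, j != i -> d1 0 j = c.1 0 j) ->
      (forall j, j != i -> d2 0 j = c.2 0 j) ->
    \prod_(j < n | j != i) Num.max 0 (d2 0 j - d1 0 j) =
    \prod_(j < n | j != i) Num.max 0 (c.2 0 j - c.1 0 j).
    by move=> d1E d2E; apply: eq_bigr => j ji; rewrite d1E// d2E.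
  rewrite (same c.1 (set_coord _ _ _))//; last by move=> j /negbTE ji; rewrite mxE ji.
  rewrite (same (set_coord _ _ _) c.2)//; last by move=> j /negbTE ji; rewrite mxE ji.
  rewrite -mulrDl; congr (_ * _).
  by rewrite /Order.min /Order.max; case: (ltP (c.2 0 i) a) => ?;
    case: (ltP (c.1 0 i) a) => ?; repeat (case: ltP => ?); lra.
have mono Y P : box_cover Y P ->
    (leb_outer R n Y <= \sum_(k <oo) (box_volume (P k))%:E)%E.
  exact: leb_le_cover.
apply: (le_trans (leeD (mono _ Q1 _) (mono _ Q2 _))).
- move=> x [/XQ[k _ Qx] xa]; exists k => //; move: Qx; rewrite /Q1.
  case: (Q k) => //= c cx j; rewrite mxE; case: eqP => [->|_]; last exact: cx.
  by have /andP[-> xc] := cx i; rewrite le_min xc xa.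
- move=> x [/XQ[k _ Qx] /negP]; rewrite -ltNge => xa; exists k => //; move: Qx; rewrite /Q2.
  case: (Q k) => //= c cx j; rewrite mxE; case: eqP => [->|_]; last exact: cx.
  by have /andP[cx1 ->] := cx i; rewrite gt_max cx1 xa.
- rewrite -nneseriesD//; try by move=> k _ _; rewrite lee_fin box_volume_ge0.
  by apply: lee_nneseries => [k _|k _]; rewrite -?EFinD ?volE// lee_fin addr_ge0 ?box_volume_ge0.
Qed.

Lemma coord_measurable {R : realType} {n : nat} (i : 'I_n) :
  measurable_fun [set: lebType R n] (fun x : 'rV[R]_n => x 0 i).
Proof.
apply: (measurability _ (RGenOInfty.measurableE R)) => _ [_ [a ->] <-].
rewrite setTI.
rewrite (_ : _ @^-1` _ = ~` [set x : 'rV[R]_n | x 0 i <= a]); last first.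
  apply/seteqP; split=> x /=; rewrite in_itv/= andbT ltNge; first by move/negP.
  by move=> /negP.
exact/measurableC/halfspace_measurable.
Qed.

Lemma mx_cvgP {R : realType} {m k : nat} {T : Type} (F : set_system T) {FF : Filter F}
    (f : T -> 'M[R]_(m, k)) (l : 'M[R]_(m, k)) :
  (forall i j, f t i j @[t --> F] --> l i j) -> f @ F --> l.
Proof.
move=> fl; apply/cvg_ballP => e e0.
have : \forall t \near F, forall i j, ball (l i j) e (f t i j).
  apply: filter_forall => i; apply: filter_forall => j.
  by move/cvg_ballP : (fl i j); exact.
by apply: filterS => t fl_t; split.
Qed.

(* The inner map is approximated by its roundings to the grids [2^-l Z], which
   take countably many values. *)
Section caratheodory_composition.
Context {R : realType} {d} {T : measurableType d} {m k : nat}.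
Variables (D : set T) (mD : measurable D) (V : T -> 'M[R]_(m, k)).
Hypothesis mV : forall i j, measurable_fun D (fun x => V x i j).

Definition grid (l : nat) (z : 'M[R]_(m, k)) : 'M[int]_(m, k) :=
  \matrix_(i, j) Num.floor (2 ^+ l * z i j).

Definition ungrid (l : nat) (Z : 'M[int]_(m, k)) : 'M[R]_(m, k) :=
  \matrix_(i, j) ((Z i j)%:~R / 2 ^+ l).

Lemma ungrid_grid l z i j : `|ungrid l (grid l z) i j - z i j| <= (2 ^+ l)^-1.
Proof.
rewrite !mxE.
have l0 : 0 < 2 ^+ l :> R by rewrite exprn_gt0.
set y := 2 ^+ l * z i j.
have -> : z i j = y / 2 ^+ l by rewrite /y mulrC mulKf// gt_eqF.
have li0 : 0 <= 2 ^- l :> R by rewrite invr_ge0 ltW.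
rewrite -mulrBl normrM [X in _ * X]ger0_norm// ler_piMl//.
have /andP[h1] := real_floor_itv (num_real y); rewrite intrD => h2.
by rewrite ler0_norm; lra.
Qed.

(** Integer matrices form a countable type, so [P] may be arbitrary: the set is a countable union of
    fibres of the rounding. *)
Lemma grid_measurable l (P : set 'M[int]_(m, k)) :
  measurable (D `&` [set x | P (grid l (V x))]).
Proof.
have -> : D `&` [set x | P (grid l (V x))] =
    \bigcup_(Z in P) (D `&` [set x | grid l (V x) = Z]).
  apply/seteqP; split => x.
    by move=> [Dx Px]; exists (grid l (V x)).
  by move=> [Z PZ [Dx /= ZE]]; split => //=; rewrite ZE.
rewrite bigcup_mkcond.
apply: countable_bigcupT_measurable => [|Z].
  exact: countableP.
case: ifP => // _.
have -> : D `&` [set x | grid l (V x) = Z] = D `&`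
    \bigcap_(ij in [set: 'I_m * 'I_k]) [set x | grid l (V x) ij.1 ij.2 = Z ij.1 ij.2].
  apply/seteqP; split => x [Dx] /= Zx; split => //; first by move=> ij _; rewrite /= Zx.
  by apply/matrixP => i j; exact: (Zx (i, j)).
(* A matrix may have no entries, and [D] can be moved inside the intersection only when the family
   of indices is nonempty. *)
have [ij0|/set0P[ij0 _]] := eqVneq [set: 'I_m * 'I_k] set0.
  by rewrite ij0 bigcap_set0 setIT.
rewrite -bigcapIr; last by exists ij0.
apply: fin_bigcap_measurable; [exact: finite_finset|].
move=> [i j] _ /=.
have -> : D `&` [set x | grid l (V x) i j = Z i j] =
    D `&` (fun x => V x i j) @^-1` [set t | (Z i j)%:~R <= 2 ^+ l * t < (Z i j + 1)%:~R].
  apply/seteqP; split => x [Dx /= H]; split => //.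
    by rewrite -H mxE real_floor_itv// num_real.
  by rewrite mxE; exact: floor_def.
apply: mV => //.
have -> : [set t : R | (Z i j)%:~R <= 2 ^+ l * t < (Z i j + 1)%:~R] =
    `[(Z i j)%:~R / 2 ^+ l, (Z i j + 1)%:~R / 2 ^+ l[%classic.
  apply/seteqP; split => t /=; rewrite in_itv/= ler_pdivrMr ?exprn_gt0//;
    by rewrite ltr_pdivlMr ?exprn_gt0// mulrC.
exact: measurable_itv.
Qed.

(** Along a rounded map the composite is glued from countably many functions [f ^~ z] with [z]
    fixed; continuity in [z] carries measurability to the limit. *)
Lemma measurable_caratheodory_comp (f : T -> 'M[R]_(m, k) -> R) :
  (forall z, measurable_fun D (f ^~ z)) ->
  (forall x, D x -> continuous (f x)) ->
  measurable_fun D (fun x => f x (V x)).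
Proof.
move=> mf cf.
apply: (@measurable_fun_cvg _ _ _ D (fun l x => f x (ungrid l (grid l (V x))))).
  move=> l _ Y mY.
  have -> : D `&` (fun x => f x (ungrid l (grid l (V x)))) @^-1` Y =
      \bigcup_(Z in [set: 'M[int]_(m, k)])
      ((D `&` [set x | grid l (V x) = Z]) `&` (D `&` (f ^~ (ungrid l Z)) @^-1` Y)).
    apply/seteqP; split => x /=; first by move=> [Dx Yx]; exists (grid l (V x)).
    by move=> [Z _ [[Dx /= ZE] [_ /= Yx]]]; split => //=; rewrite ZE.
  apply: countable_bigcupT_measurable => [|Z]; first exact: countableP.
  apply: measurableI; last exact: mf.
  exact: (grid_measurable l [set Z]).
move=> x Dx; apply: continuous_cvg; first exact: cf.
apply: mx_cvgP => i j; apply/cvgrPdist_le => e e0.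
near=> l; rewrite distrC (le_trans (ungrid_grid _ _ _ _))//.
rewrite -exprVn -[leLHS]ger0_norm ?exprn_ge0//.
near: l; have : GRing.exp (2^-1 : R) @ \oo --> 0 by apply: cvg_expr; rewrite ger0_norm; lra.
by move=> /cvgr0Pnorm_le; exact.
Unshelve. all: by end_near. Qed.


End caratheodory_composition.

(** Membership in an open set is visible on the roundings: at some level the whole cell of radius
    [2^-l] around the rounding of [V x] lies in [U]. The preimage is thus a countable union of grid
    sets. *)
Lemma measurable_preimage_open {R : realType} {d} {T : measurableType d} {m k : nat}
    (D : set T) (V : T -> 'M[R]_(m, k)) (U : set 'M[R]_(m, k)) :
  measurable D -> (forall i j, measurable_fun D (fun x => V x i j)) -> open U ->
  measurable (D `&` V @^-1` U).
Proof.
move=> mD mV oU.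
pose P (l : nat) : set 'M[int]_(m, k) :=
  [set Z | forall y : 'M[R]_(m, k), (forall i j, `|ungrid l Z i j - y i j| <= (2 ^+ l)^-1) -> U y].
have -> : D `&` V @^-1` U = \bigcup_l (D `&` [set x | P l (grid l (V x))]).
  apply/seteqP; split => x; last first.
    by move=> [l _ [Dx /= Px]]; split => //=; apply: Px => i j; exact: ungrid_grid.
  move=> [Dx /= Ux].
  have /nbhs_ballP[e /= e0 eU] : nbhs (V x) U by exact: open_nbhs_nbhs.
  (* The factor 2 counts the distance from [V x] to its rounding and from there to [y]. *)
  have [l _ hl] : \forall l \near \oo, 2 * (2 ^+ l)^-1 < e.
    have /cvgr0Pnorm_lt H : GRing.exp (2^-1 : R) @ \oo --> 0.
      by apply: cvg_expr; rewrite ger0_norm; lra.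
    have /H : 0 < e / 2 by rewrite divr_gt0.
    apply: filterS => l; rewrite exprVn.
    by rewrite ger0_norm ?invr_ge0 ?exprn_ge0//; lra.
  exists l => //; split => //= y Hy; apply: eU; split => // i j.
  have := hl l (leqnn l); have := Hy i j; have := ungrid_grid l (V x) i j.
  move=> h1 h2 h3; rewrite /ball /=.
  apply: (@le_lt_trans _ _ (2 * (2 ^+ l)^-1)) => //.
  by rewrite (le_trans (ler_distD (ungrid l (grid l (V x)) i j) _ _))// distrC; lra.
by apply: bigcupT_measurable => l; exact: grid_measurable.
Qed.

Lemma measurable_continuous_comp {R : realType} {d} {T : measurableType d} {m k : nat}
    (D : set T) (V : T -> 'M[R]_(m, k)) (g : 'M[R]_(m, k) -> R) :
  measurable D -> (forall i j, measurable_fun D (fun x => V x i j)) -> continuous g ->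
  measurable_fun D (fun x => g (V x)).
Proof.
move=> mD mV cg; apply: (measurable_caratheodory_comp mD mV (f := fun=> g)) => //.
Qed.

Section leb_borel.
Context {R : realType} {n : nat}.
Local Notation T := (lebType R n).

Lemma coord_measurable_rV (D : set T) (i : 'I_1) (j : 'I_n) : measurable D ->
  measurable_fun D (fun x : 'rV[R]_n => x i j).
Proof.
by move=> mD; rewrite ord1; apply: measurable_funTS; exact: coord_measurable.
Qed.

(** Measurability in [lebType] is Caratheodory's condition, so open sets have to be recovered from
    half-spaces, through the coordinates of the identity map. *)
Lemma leb_open_measurable (U : set 'rV[R]_n) : open U -> measurable (U : set T).
Proof.
move=> oU; rewrite -[X in measurable X](setTI (id @^-1` U)).
refine (measurable_preimage_open (T := T) (V := id) measurableT _ oU) => i j.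
exact: coord_measurable_rV.
Qed.

Lemma leb_closed_measurable (U : set 'rV[R]_n) : closed U -> measurable (U : set T).
Proof.
move=> cU; rewrite -[X in measurable X]setCK; apply: measurableC.
by apply: leb_open_measurable; rewrite openC.
Qed.

Lemma leb_compact_measurable (U : set 'rV[R]_n) : compact U -> measurable (U : set T).
Proof. by move=> /compact_closed cU; apply/leb_closed_measurable/cU/norm_hausdorff. Qed.

Lemma leb_continuous_measurable (g : 'rV[R]_n -> R) (D : set T) :
  measurable D -> continuous g -> measurable_fun D g.
Proof.
move=> mD cg; refine (measurable_continuous_comp (T := T) (V := id) mD _ cg) => i j.
exact: coord_measurable_rV.
Qed.

Definition cube (M : R) : set 'rV[R]_n := [set x | `|x| < M].

Lemma leb_cube_lty M : (leb R n (cube M) < +oo)%E.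
Proof.
apply: (@le_lt_trans _ _ (box_volume (Some (const_mx (- M), const_mx M)))%:E); last exact: ltry.
apply: leb_le_box => x xM i; rewrite !mxE.
have : `|x 0 i| < M by rewrite (le_lt_trans _ xM)// [leRHS]mx_normrE; exact: (le_bigmax _ (fun i : 'I_1 * 'I_n => `|x i.1 i.2|) (0, i)).
by rewrite ltr_norml => /andP[-> /ltW].
Qed.

Lemma cube_open M : open (cube M).
Proof.
by apply: (@open_comp _ _ (fun x : 'rV[R]_n => `|x|) [set r | r < M]) => // x _; exact: norm_continuous.
Qed.

Lemma leb_bounded_lty (A : set 'rV[R]_n) : bounded_set A -> (leb R n A < +oo)%E.
Proof.
move=> [M [Mr AM]]; apply: le_lt_trans (leb_cube_lty (M + 2)).
apply: le_outer_measure => x Ax; rewrite /cube /=.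
have : `|x| <= M + 1 by apply: AM => //; lra.
lra.
Qed.

(** This is what Tonelli's theorem will ask of the measure. *)
Lemma leb_sigma_finite : sigma_finite setT (leb R n).
Proof.
exists (fun k => cube k%:R).
  apply/seteqP; split => // x _; exists (Num.truncn `|x|).+1 => //.
  by rewrite /cube/= truncnS_gt.
move=> k; split; first exact/leb_open_measurable/cube_open.
exact: leb_cube_lty.
Qed.

HB.instance Definition _ := Measure_isSigmaFinite.Build _ _ _ (leb R n) leb_sigma_finite.

End leb_borel.

(** * Dilations and translations of Lebesgue measure *)

Section leb_affine.
Context {R : realType} {n : nat}.
Local Notation T := (lebType R n).

Definition affine (a : R) (b x : 'rV[R]_n) : 'rV[R]_n := a *: x + b.

Lemma affineK (a : R) (b : 'rV[R]_n) : a != 0 ->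
  cancel (affine a b) (affine a^-1 (- (a^-1 *: b))).
Proof. by move=> a0 x; rewrite /affine scalerDr scalerA mulVf// scale1r addrK. Qed.

Lemma affineVK (a : R) (b : 'rV[R]_n) : a != 0 ->
  cancel (affine a^-1 (- (a^-1 *: b))) (affine a b).
Proof.
by move=> a0 x; rewrite /affine scalerDr scalerN !scalerA divff// !scale1r subrK.
Qed.

(** The inverse map carries every box cover of [A] to a cover of the preimage and multiplies each
    volume by [a ^- n]. Applied to the inverse map, the same bound gives the reverse inequality. *)
Let leb_affine_le (a : R) (b : 'rV[R]_n) (A : set 'rV[R]_n) : 0 < a ->
  (leb_outer R n (affine a b @^-1` A) <= (a ^- n)%:E * leb_outer R n A)%E.
Proof.
move=> a0; have an0 : 0 < a ^+ n by rewrite exprn_gt0.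
rewrite lee_pdivlMl//; apply: le_ereal_inf_tmp => _ [Q AQ <-].
rewrite -lee_pdivlMl//.
pose S (c : 'rV[R]_n * 'rV[R]_n) := (a^-1 *: (c.1 - b), a^-1 *: (c.2 - b)).
pose Q' k := if Q k is Some c then Some (S c) else None.
have volE k : box_volume (Q' k) = a ^- n * box_volume (Q k).
  rewrite /Q'; case: (Q k) => [c|] /=; last by rewrite mulr0.
  have -> : a ^- n = \prod_(i < n) a^-1 by rewrite prodr_const card_ord exprVn.
  rewrite -big_split/=; apply: eq_bigr => i _.
  rewrite !mxE -mulrBr maxr_pMr ?invr_ge0; last exact: ltW.
  by rewrite mulr0; congr (Num.max 0 (_ * _)); ring.
have AQ' : box_cover (affine a b @^-1` A) Q'.
  move=> x /AQ[k _ Qx]; exists k => //; move: Qx; rewrite /Q'.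
  case: (Q k) => //= c cx i; have := cx i; rewrite !mxE => /andP[c1 c2].
  by rewrite ltr_pdivrMl// ler_pdivlMl// ltrBlDr lerBrDr c1.
apply: (le_trans (leb_le_cover AQ')).
rewrite -nneseriesZl//; last by move=> k _; rewrite lee_fin box_volume_ge0.
by under eq_eseriesr do rewrite volE EFinM.
Qed.

Lemma leb_affine (a : R) (b : 'rV[R]_n) (A : set 'rV[R]_n) : 0 < a ->
  leb_outer R n (affine a b @^-1` A) = ((a ^- n)%:E * leb_outer R n A)%E.
Proof.
move=> a0; apply/eqP; rewrite eq_le leb_affine_le//=.
have an0 : 0 < a ^+ n by rewrite exprn_gt0.
rewrite lee_pdivrMl//.
have := @leb_affine_le a^-1 (- (a^-1 *: b)) (affine a b @^-1` A).
rewrite invr_gt0 => /(_ a0); rewrite exprVn invrK; apply: le_trans.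
by apply: le_outer_measure => x Ax /=; rewrite affineVK// gt_eqF.
Qed.

(** Both sides carry the complete sigma-algebra, so continuity alone would not suffice.
    Caratheodory's condition is transported instead: each test set [Y] is the preimage of some [Z],
    and outer measures of preimages all scale by the same factor. *)
Lemma measurable_affine (a : R) (b : 'rV[R]_n) : 0 < a ->
  measurable_fun [set: T] (affine a b : T -> T).
Proof.
move=> a0 _ X mX; rewrite setTI.
suff : (leb_outer R n).-caratheodory (affine a b @^-1` X) by [].
move=> Y; set Z := affine a^-1 (- (a^-1 *: b)) @^-1` Y.
have -> : Y = affine a b @^-1` Z.
  by apply/seteqP; split => x; rewrite /Z/= affineK// gt_eqF.
have ZX : leb_outer R n Z = (leb_outer R n (Z `&` X) + leb_outer R n (Z `&` ~` X))%E.
  exact: mX.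
change (leb_outer R n (affine a b @^-1` Z) =
  (leb_outer R n (affine a b @^-1` (Z `&` X)) +
   leb_outer R n (affine a b @^-1` (Z `&` ~` X)))%E).
transitivity ((a ^- n)%:E * leb_outer R n Z)%E; first exact: leb_affine.
rewrite ZX ge0_muleDr ?outer_measure_ge0//.
by congr (_ + _)%E; apply/esym; exact: leb_affine.
Qed.

Lemma ge0_integral_affine (a : R) (b : 'rV[R]_n) (g : T -> \bar R) : 0 < a ->
  measurable_fun setT g -> (forall x, 0 <= g x)%E ->
  (\int[leb R n]_x g (affine a b x) = (a ^- n)%:E * \int[leb R n]_x g x)%E.
Proof.
move=> a0 mg g0; have man := measurable_affine b a0.
have an0 : 0 <= a ^- n by rewrite invr_ge0 exprn_ge0// ltW.
transitivity (\int[pushforward (leb R n) (affine a b : T -> T)]_x g x)%E.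
  by rewrite ge0_integral_pushforward// preimage_setT.
rewrite (eq_measure_integral (mscale (NngNum an0) (leb R n))); last first.
  by move=> A mA _; rewrite /= /mscale /pushforward/=; exact: leb_affine.
by rewrite ge0_integral_mscale.
Qed.

Definition translate (b x : 'rV[R]_n) : 'rV[R]_n := x + b.

Lemma measurable_translate (b : 'rV[R]_n) : measurable_fun [set: T] (translate b : T -> T).
Proof.
have := measurable_affine b (@ltr01 R); congr (measurable_fun _ _).
by apply/funext => x; rewrite /affine scale1r.
Qed.

Lemma integrable_translate (b : 'rV[R]_n) (g : T -> \bar R) :
  (leb R n).-integrable setT g -> (leb R n).-integrable setT (g \o translate b).
Proof.
move=> /integrableP[mg ig]; apply/integrableP; split.
  by apply: measurableT_comp => //; exact: measurable_translate.
apply: le_lt_trans ig.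
have mng : measurable_fun [set: T] (fun x => `|g x|)%E by exact: measurableT_comp.
have := ge0_integral_affine b ltr01 mng (fun x => abse_ge0 _).
rewrite expr1n invr1 mul1e => /eqP; rewrite eq_le => /andP[+ _]; apply: le_trans.
by under [leRHS]eq_integral do rewrite /affine scale1r.
Qed.

Lemma integral_translate (b : 'rV[R]_n) (g : T -> \bar R) :
  (leb R n).-integrable setT g ->
  (\int[leb R n]_x g (x + b)%R = \int[leb R n]_x g x)%E.
Proof.
move=> ig; have mtr := measurable_translate b.
transitivity (\int[pushforward (leb R n) (translate b : T -> T)]_x g x)%E.
  rewrite integral_pushforward//; first by case/integrableP : ig.
  exact: integrable_translate.
apply: eq_measure_integral => A mA _.
have := leb_affine b A (@ltr01 R); rewrite expr1n invr1 mul1e; apply: etrans.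
by congr (leb_outer R n _); apply/seteqP; split => x; rewrite /affine/= scale1r.
Qed.

End leb_affine.

(** * Outer regularity of Lebesgue measure *)

Section outer_regularity.
Context {R : realType} {n : nat}.
Local Notation T := (lebType R n).

(** Pushing the upper corner outwards by [d > 0] puts the half-open box inside an open one, whose
    volume depends continuously on [d]. *)
Let open_box_cover (b : option ('rV[R]_n * 'rV[R]_n)) (e : R) : 0 < e ->
  exists U : set 'rV[R]_n, [/\ open U, box b `<=` U &
    (leb R n U <= (box_volume b + e)%:E)%E].
Proof.
move=> e0; case: b => [c|]; last first.
  exists set0; split => //.
  by rewrite measure0 lee_fin/= add0r ltW.
have /cvgrPdist_lt H : box_volume (Some (c.1, \row_i (c.2 0 i + d))) @[d --> 0^'+] -->
    box_volume (Some c).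
  apply: (@cvg_at_right_filter R R); rewrite /box_volume.
  apply: cvg_big => [|i _]; first exact: mul_continuous.
  under eq_fun do rewrite mxE/=.
  have -> : c.2 0 i - c.1 0 i = c.2 0 i + 0 - c.1 0 i by rewrite addr0.
  apply: (@continuous2_cvg _ _ _ _ _ _ (fun=> 0) _ (fun x y : R => Num.max x y)).
    + exact: (@max_continuous _ R (0, c.2 0 i + 0 - c.1 0 i)).
    + exact: cvg_cst.
   
  by apply: cvgB; [apply: cvgD; [exact: cvg_cst|exact: cvg_id]|exact: cvg_cst].
have [d [d0]] : exists d, 0 < d /\
    `|box_volume (Some c) - box_volume (Some (c.1, \row_i (c.2 0 i + d)))| < e.
  near (0 : R)^'+ => d; exists d; split => //.
  by near: d; exact: H.
set c' := (c.1, _) => cc'.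
exists [set x | forall i, c'.1 0 i < x 0 i < c'.2 0 i]; split.
- rewrite openE => x xc.
  have Hi i : nbhs x [set y : 'rV[R]_n | c'.1 0 i < y 0 i < c'.2 0 i].
    apply: (@open_nbhs_nbhs _ _ ((fun y : 'rV[R]_n => y 0 i) @^-1` `]c'.1 0 i, c'.2 0 i[)).
    split; last by rewrite /= in_itv/= xc.
    apply: open_comp => [y _|]; first exact: (@coord_continuous _ _ _ 0 i).
    exact: interval_open.
  exact: (filter_forall (nbhs_filter x) Hi).
- by move=> x xc i; have /andP[-> x2] := xc i; rewrite /c'/= mxE; lra.
- apply: (@le_trans _ _ (box_volume (Some c'))%:E).
    by apply: leb_le_box => x xc i; have /andP[-> /ltW ->] := xc i.
  by rewrite lee_fin; move: cc'; rewrite ltr_norml; lra.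
Unshelve. all: by end_near. Qed.

Lemma leb_outer_regular (A : set 'rV[R]_n) (e : R) : 0 < e -> (leb R n A < +oo)%E ->
  exists U : set 'rV[R]_n, [/\ open U, A `<=` U & (leb R n U <= leb R n A + e%:E)%E].
Proof.
move=> e0 Aoo; have e20 : 0 < e / 2 by rewrite divr_gt0.
have fA : leb_outer R n A \is a fin_num by rewrite ge0_fin_numE ?outer_measure_ge0.
have [_ [Q AQ <-] Qlt] := lb_ereal_inf_adherent e20 fA.
(* Half of [e] pays for the near-optimal cover; the other half is shared geometrically among the
   open enlargements. *)
have d0 k : 0 < e / 2 / (2 ^ k.+1)%:R by rewrite divr_gt0// ltr0n expn_gt0.
have /choice[U hU] := fun k => open_box_cover (Q k) (d0 k).
exists (\bigcup_k U k); split.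
- by apply: bigcup_open => k _; have [] := hU k.
- by move=> x /AQ[k _ Qx]; exists k => //; have [_ + _] := hU k; exact.
apply: (@le_trans _ _ (\sum_(k <oo) (box_volume (Q k) + e / 2 / (2 ^ k.+1)%:R)%:E)%E).
  apply: (le_trans (outer_measure_sigma_subadditive (leb_outer R n) U)).
  apply: lee_nneseries => [k *|k *]; first exact: outer_measure_ge0.
  by have [] := hU k.
under eq_eseriesr do rewrite EFinD.
apply: (le_trans (epsilon_trick _ _ _)).
- by move=> k; rewrite lee_fin box_volume_ge0.
- exact: ltW.
have -> : e%:E = ((e / 2)%:E + (e / 2)%:E)%E by rewrite -EFinD -splitr.
by rewrite addeA; apply: leeD2r; exact: ltW.
Qed.

End outer_regularity.

(** * Convex functions on matrix spaces *)

Definition convexE {R : realType} {V : lmodType R} (g : V -> R) : Prop :=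
  forall t x y, 0 <= t <= 1 -> g (t *: x + (1 - t) *: y) <= t * g x + (1 - t) * g y.

Lemma convex_functionE {R : realType} {m k : nat} (g : 'M[R]_(m, k) -> R) :
  convex_function setT g -> convexE g.
Proof.
move=> cg t x y /andP[t0 t1].
by have := cg (Itv01 t0 t1) x y (mem_set Logic.I) (mem_set Logic.I); rewrite !convRE.
Qed.

(** Unnormalized weights are the form in which difference quotients over two steps of different
    lengths are compared. *)
Lemma convexE_weights {R : realType} {V : lmodType R} (g : V -> R) (r s : R) x y z :
  convexE g -> 0 < r -> 0 < s -> (r + s) *: z = s *: x + r *: y ->
  (r + s) * g z <= s * g x + r * g y.
Proof.
move=> cg r0 s0 zE; have rs0 : 0 < r + s by rewrite addr_gt0.
have t01 : 0 <= s / (r + s) <= 1.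
  by rewrite ler_pdivrMr// mul1r divr_ge0/=; lra.
have tE : 1 - s / (r + s) = r / (r + s) by field; rewrite gt_eqF.
have := cg _ x y t01; rewrite tE.
have -> : (s / (r + s)) *: x + (r / (r + s)) *: y = z.
  apply: (@scalerI _ _ (r + s)); first by rewrite gt_eqF.
  by rewrite zE scalerDr !scalerA !(mulrC (r + s)) !divfK// gt_eqF.
rewrite -(ler_pM2l rs0); congr (_ <= _).
by field; rewrite gt_eqF.
Qed.

Section subgradient.
Context {R : realType} {m k : nat}.
Implicit Types (g : 'M[R]_(m, k) -> R) (s : seq ('I_m * 'I_k)) (L z : 'M[R]_(m, k)).

Definition mxdot L z : R := \sum_i \sum_j L i j * z i j.

Lemma mxdotD L x y : mxdot L (x + y) = mxdot L x + mxdot L y.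
Proof.
rewrite /mxdot -big_split/=; apply: eq_bigr => i _; rewrite -big_split/=.
by apply: eq_bigr => j _; rewrite mxE mulrDr.
Qed.

Lemma mxdotZ L a x : mxdot L (a *: x) = a * mxdot L x.
Proof.
rewrite /mxdot mulr_sumr; apply: eq_bigr => i _; rewrite mulr_sumr.
by apply: eq_bigr => j _; rewrite mxE mulrCA.
Qed.

Lemma mxdotDl L L' x : mxdot (L + L') x = mxdot L x + mxdot L' x.
Proof.
rewrite /mxdot -big_split/=; apply: eq_bigr => i _; rewrite -big_split/=.
by apply: eq_bigr => j _; rewrite mxE mulrDl.
Qed.

Lemma mxdot_delta c i j x : mxdot (c *: delta_mx i j) x = c * x i j.
Proof.
rewrite /mxdot (bigD1 i)//= [X in _ + X]big1 ?addr0; last first.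
  by move=> i' /negbTE ii'; apply: big1 => j' _; rewrite !mxE ii' mulr0 mul0r.
rewrite (bigD1 j)//= [X in _ + X]big1 ?addr0; last first.
  by move=> j' /negbTE jj'; rewrite !mxE jj' andbF mulr0 mul0r.
by rewrite !mxE !eqxx mulr1.
Qed.

Let supported s z := forall i j, (i, j) \notin s -> z i j = 0.

(* Hahn-Banach for a convex majorant, one coordinate at a time. *)
Let subgradient_seq g z0 s : convexE g -> exists L, forall h, supported s h ->
  g z0 + mxdot L h <= g (z0 + h).
Proof.
move=> cg; elim: s => [|[i0 j0] s [L IH]].
  exists 0 => h h0.
  have -> : h = 0 by apply/matrixP => i j; rewrite mxE h0.
  rewrite addr0 /mxdot big1 ?addr0// => i _; rewrite big1// => j _.
  by rewrite mxE mul0r.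
have [ij0s|ij0s] := boolP ((i0, j0) \in s).
  exists L => h hs; apply: IH => i j ijs; apply: hs.
  by rewrite in_cons negb_or ijs andbT; apply: contra ijs => /eqP ->.
pose E : 'M[R]_(m, k) := delta_mx i0 j0.
(* Every left slope along [E] is at most every right slope, even at different base points: with
   weights [t] and [r] the displacements along [E] cancel, and the induction hypothesis bounds [g]
   from below at the averaged point. *)
have sep h h' r t : supported s h -> supported s h' -> 0 < r -> 0 < t ->
    (g z0 + mxdot L h - g (z0 + h - r *: E)) / r <=
    (g (z0 + h' + t *: E) - g z0 - mxdot L h') / t.
  move=> hs hs' r0 t0; have rt0 : 0 < r + t by rewrite addr_gt0.
  rewrite ler_pdivrMr// mulrAC ler_pdivlMr//.
  pose h'' := (r + t)^-1 *: (t *: h + r *: h').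
  have hs'' : supported s h'' by move=> i j ijs; rewrite !mxE hs// hs'// !mulr0 addr0 mulr0.
  have H1 := IH _ hs''.
  have H2 : (r + t) * g (z0 + h'') <= t * g (z0 + h - r *: E) + r * g (z0 + h' + t *: E).
    apply: convexE_weights => //.
    rewrite /h'' scalerDr scalerA divff ?gt_eqF// scale1r.
    rewrite !scalerDr scalerN !scalerA (mulrC t r) scalerDl.
    by apply/matrixP => i j; rewrite !mxE; ring.
  have H3 : (r + t) * mxdot L h'' = t * mxdot L h + r * mxdot L h'.
    by rewrite mxdotZ mulrA divff ?gt_eqF// mul1r mxdotD !mxdotZ.
  have : (r + t) * (g z0 + mxdot L h'') <= (r + t) * g (z0 + h'') by rewrite ler_pM2l.
  rewrite mulrDr H3; lra.
pose S := [set c | exists h r, [/\ supported s h, 0 < r &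
   c = (g z0 + mxdot L h - g (z0 + h - r *: E)) / r]].
have supp0 : supported s 0 by move=> i j _; rewrite mxE.
have S_ub h' t : supported s h' -> 0 < t ->
    ubound S ((g (z0 + h' + t *: E) - g z0 - mxdot L h') / t).
  by move=> hs' t0 _ [h [r [hs r0 ->]]]; exact: sep.
have S0 : S !=set0.
  by exists ((g z0 + mxdot L 0 - g (z0 + 0 - 1 *: E)) / 1), 0, 1.
have hubS : has_ubound S by eexists; exact: (S_ub 0 1).
(* Any number separating left slopes from right slopes can be the new coefficient; the supremum of
   the left ones is such a number. *)
pose c := sup S.
have c_ge h r : supported s h -> 0 < r ->
    (g z0 + mxdot L h - g (z0 + h - r *: E)) / r <= c.
  by move=> hs r0; apply: ub_le_sup => //; exists h, r.
have c_le h t : supported s h -> 0 < t ->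
    c <= (g (z0 + h + t *: E) - g z0 - mxdot L h) / t.
  by move=> hs t0; apply: ge_sup => //; exact: S_ub.
(* The correction replaces the entry of [L] at [(i0, j0)] by [c]. *)
exists (L + (c - L i0 j0) *: E) => z zs.
pose t := z i0 j0; pose h := z - t *: E.
have hs : supported s h.
  move=> i j ijs; rewrite !mxE; have [/andP[/eqP -> /eqP ->]|ij] := boolP ((i == i0) && (j == j0)).
    by rewrite mulr1 subrr.
  by rewrite mulr0 subr0 zs// in_cons negb_or ijs andbT.
have zE : z = h + t *: E by rewrite /h subrK.
have -> : mxdot (L + (c - L i0 j0) *: E) z = mxdot L h + t * c.
  rewrite mxdotDl mxdot_delta -/t zE mxdotD mxdotZ.
  have -> : mxdot L E = L i0 j0.
    rewrite /mxdot (bigD1 i0)//= [X in _ + X]big1 ?addr0; last first.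
      by move=> i' /negbTE ii'; apply: big1 => j' _; rewrite !mxE ii' mulr0.
    rewrite (bigD1 j0)//= [X in _ + X]big1 ?addr0; last first.
      by move=> j' /negbTE jj'; rewrite !mxE jj' andbF mulr0.
    by rewrite !mxE !eqxx mulr1.
  ring.
rewrite zE (addrA z0); have [t0|t0|t0] := ltgtP t 0.
- have := c_ge h (- t) hs; rewrite oppr_gt0 => /(_ t0).
  by rewrite ler_pdivrMr ?oppr_gt0// scaleNr opprK; lra.
- by have := c_le h t hs t0; rewrite ler_pdivlMr//; lra.
- by rewrite t0 scale0r addr0 mul0r addr0; exact: IH.
Qed.

Lemma subgradient g z0 : convexE g ->
  exists L, forall z, g z0 + mxdot L (z - z0) <= g z.
Proof.
move=> cg; have [L HL] := subgradient_seq z0 (enum {: 'I_m * 'I_k}) cg.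
exists L => z; have := HL (z - z0); rewrite (addrC z0 (z - z0)) subrK; apply.
by move=> i j; rewrite mem_enum.
Qed.

Lemma mxdot_bound L z e : (forall i j, `|z i j| <= e) ->
  `|mxdot L z| <= e * \sum_i \sum_j `|L i j|.
Proof.
move=> ze; rewrite /mxdot mulr_sumr (le_trans (ler_norm_sum _ _ _))// ler_sum// => i _.
rewrite mulr_sumr (le_trans (ler_norm_sum _ _ _))// ler_sum// => j _.
by rewrite normrM mulrC ler_wpM2r.
Qed.

(** The point [z0 + h] is the midpoint of [z0 + 2 *: h'] and [z0 + (2 * t) *: E], which separates
    one coordinate from the rest. Each separation doubles the displacement, whence the radius
    [e / 2 ^+ size s]. *)
Let convex_upper_seq g z0 s : convexE g -> exists C : R, forall (h : 'M[R]_(m, k)) (e : R), 0 <= e <= 1 ->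
  (forall i j, `|h i j| <= e / 2 ^+ size s) -> supported s h ->
  g (z0 + h) <= g z0 + C * e.
Proof.
move=> cg; elim: s => [|[i0 j0] s [C IH]].
  exists 0 => h e _ _ h0; have -> : h = 0 by apply/matrixP => i j; rewrite mxE h0.
  by rewrite addr0 mul0r addr0.
pose E : 'M[R]_(m, k) := delta_mx i0 j0.
(* Convexity on the segments from [z0] to [z0 + E] and to [z0 - E] bounds the growth of [g] there by
   the increments at their ends; [D] covers both signs of [t]. *)
pose D := `|g (z0 + E) - g z0| + `|g (z0 - E) - g z0|.
exists ((C + D) / 2) => h e /andP[e0 e1] he hs.
pose t := h i0 j0; pose h' := h - t *: E.
have h'0 : h' i0 j0 = 0 by rewrite !mxE !eqxx mulr1 subrr.
have h'E i j : (i, j) != (i0, j0) -> h' i j = h i j.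
  rewrite xpair_eqE !mxE => /negbTE ->; by rewrite mulr0 subr0.
have s0 : 0 < 2 ^+ size s :> R by rewrite exprn_gt0.
have D0 : 0 <= D by rewrite addr_ge0.
have H1 : g (z0 + 2 *: h') <= g z0 + C * e.
  apply: IH => [|i j|i j ijs]; first by rewrite e0.
    rewrite mxE; have [[-> ->]|/eqP ij] := pselect ((i, j) = (i0, j0)).
      by rewrite h'0 mulr0 normr0 divr_ge0// ltW.
    rewrite h'E// normrM ger0_norm//; have := he i j.
    rewrite /= exprS invfM (mulrC 2^-1) mulrA ler_pdivlMr// mulrC; exact.
  rewrite mxE; have [[-> ->]|/eqP ij] := pselect ((i, j) = (i0, j0)).
    by rewrite h'0 mulr0.
  by rewrite h'E// hs ?mulr0// in_cons negb_or ij.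
have te : 2 * `|t| <= e.
  have := he i0 j0; rewrite -/t /= ler_pdivlMr ?exprn_gt0// exprS => te.
  apply: le_trans te; rewrite mulrCA ler_pM2l// ler_peMr// exprn_ege1//; lra.
have H2 : g (z0 + (2 * t) *: E) <= g z0 + D * e.
  have [t0|t0] := leP 0 t.
    rewrite ger0_norm// in te.
    have := cg (2 * t) (z0 + E) z0.
    have -> : (2 * t) *: (z0 + E) + (1 - 2 * t) *: z0 = z0 + (2 * t) *: E.
      by apply/matrixP => i j; rewrite !mxE; ring.
    have -> : 0 <= 2 * t <= 1 by lra.
    move=> /(_ isT) /le_trans; apply.
    have : 2 * t * (g (z0 + E) - g z0) <= e * D.
      apply: (@le_trans _ _ (2 * t * D)); last by rewrite ler_wpM2r.
      rewrite ler_wpM2l//; first lra.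
      by rewrite (le_trans (ler_norm _))// lerDl.
    lra.
  rewrite ltr0_norm// in te.
  have := cg (- (2 * t)) (z0 - E) z0.
  have -> : (- (2 * t)) *: (z0 - E) + (1 - - (2 * t)) *: z0 = z0 + (2 * t) *: E.
    by apply/matrixP => i j; rewrite !mxE; ring.
  have -> : 0 <= - (2 * t) <= 1 by lra.
  move=> /(_ isT) /le_trans; apply.
  have : - (2 * t) * (g (z0 - E) - g z0) <= e * D.
    apply: (@le_trans _ _ (- (2 * t) * D)); last by rewrite ler_wpM2r//; lra.
    rewrite ler_wpM2l//; first lra.
    by rewrite (le_trans (ler_norm _))// lerDr.
  lra.
have := cg (1 / 2) (z0 + 2 *: h') (z0 + (2 * t) *: E).
have -> : (1 / 2) *: (z0 + 2 *: h') + (1 - 1 / 2) *: (z0 + (2 * t) *: E) = z0 + h.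
  by rewrite /h'; apply/matrixP => i j; rewrite !mxE; field.
have -> : 0 <= (1 / 2 : R) <= 1 by lra.
by move=> /(_ isT) /le_trans; apply; lra.
Qed.

(** The upper estimate is [convex_upper_seq], the lower one the affine minorant at [z0]; both are
    linear in the size of the displacement. *)
Lemma convexE_continuous g : convexE g -> continuous g.
Proof.
move=> cg z0; have [L HL] := subgradient z0 cg.
have [C HC] := convex_upper_seq z0 (enum {: 'I_m * 'I_k}) cg.
set N := size _ in HC.
pose S := \sum_i \sum_j `|L i j|.
have S0 : 0 <= S by rewrite sumr_ge0// => i _; rewrite sumr_ge0.
apply/(@cvgrPdist_le _ _ _ (nbhs z0) (nbhs_filter z0)) => e e0.
pose M := `|C| + S + 1; have M0 : 0 < M by rewrite ltr_wpDl// addr_ge0.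
pose d := Num.min 1 (e / M).
have d0 : 0 < d by rewrite lt_min ltr01 divr_gt0.
have d1 : d <= 1 by rewrite ge_min lexx.
have dM : d * M <= e by rewrite -ler_pdivlMr// ge_min lexx orbT.
have N0 : 0 < 2 ^+ N :> R by rewrite exprn_gt0.
apply/nbhs_ballP; exists (d / 2 ^+ N) => /=; first by rewrite divr_gt0.
move=> z [_ z0z]; pose h := z - z0.
have hd i j : `|h i j| <= d / 2 ^+ N by rewrite !mxE distrC ltW//; exact: z0z.
have hd' i j : `|h i j| <= d.
  rewrite (le_trans (hd i j))// ler_pdivrMr// ler_peMr//; first exact: ltW.
  by rewrite exprn_ege1//; lra.
have zE : z = z0 + h by rewrite addrC subrK.
have up : g z <= g z0 + C * d.
  rewrite zE; apply: HC => //; first by rewrite ltW.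
  by move=> i j; rewrite mem_enum.
have := HL z; have := mxdot_bound L hd'; rewrite -/h -/S ler_norml => /andP[lo _] low.
have Cd : C * d <= `|C| * d by rewrite ler_wpM2r ?ler_norm// ltW.
have Cd0 : 0 <= `|C| * d by rewrite mulr_ge0// ltW.
have Sd0 : 0 <= S * d by rewrite mulr_ge0// ltW.
rewrite ler_norml; move: dM; rewrite /M; lra.
Qed.

End subgradient.

(** * Approximate identities *)

(* Choosing the points of a sequence fast enough gives any countable family of
   eventual properties for free. *)
Lemma cvg_at_right0_seq {R : realType} {X : topologicalType} (F : R -> X) (l : X)
    (P : nat -> R -> Prop) :
  (forall k, \forall e \near 0^'+, P k e) ->
  (forall s : nat -> R, (forall k, 0 < s k) -> s k @[k --> \oo] --> 0 ->
    (forall k, P k (s k)) -> F (s k) @[k --> \oo] --> l) ->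
  F e @[e --> 0^'+] --> l.
Proof.
move=> hP hs A lA; apply: contrapT => nA.
have [s sP] : {s : nat -> R & forall k, [/\ 0 < s k, s k < k.+1%:R^-1, P k (s k) & ~ A (F (s k))]}.
  apply: (@choice _ _ (fun k e => [/\ 0 < e, e < k.+1%:R^-1, P k e & ~ A (F e)])) => k.
  apply: contrapT => nex; apply: nA.
  have : \forall e \near (0 : R)^'+, [/\ 0 < e, e < k.+1%:R^-1 & P k e].
    near=> e; split; near: e.
    - exact: nbhs_right_gt.
    - by apply: nbhs_right_lt; rewrite invr_gt0.
    - exact: hP.
  apply: filterS => e [e0 ek Pe]; apply: contrapT => nAe.
  by apply: nex; exists e.
have s0 : s k @[k --> \oo] --> 0.
  apply: (@squeeze_cvgr _ _ _ _ (fun=> 0) (fun k : nat => k.+1%:R^-1)).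
  - by near=> k; have [/ltW -> /ltW ->] := sP k.
  - exact: cvg_cst.
  - exact: cvg_harmonic.
have := hs s (fun k => let: And4 h _ _ _ := sP k in h) s0 (fun k => let: And4 _ _ h _ := sP k in h).
move=> /(_ A lA)[N _ /(_ N (leqnn N))] /=.
by have [_ _ _] := sP N.
Unshelve. all: by end_near. Qed.

Section kernel_operator.
Context {R : realType} {d} {T : measurableType d}.
Variable mu : {sigma_finite_measure set T -> \bar R}.
Implicit Types (k : T -> T -> R) (h g : T -> R).

Definition kconv k h (x : T) : R := \int[mu]_y (h y * k x y).

Definition L1 h := mu.-integrable setT (EFin \o h : T -> \bar R).

Lemma L1_measurable h : L1 h -> measurable_fun (setT : set T) h.
Proof. by move=> /measurable_int /measurable_EFinP. Qed.

(** Unit mass in [x] yields, by Tonelli, a contraction of [L^1]; unit mass in [y] makes [kconv] an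
    average, as Jensen's inequality requires. Boundedness keeps [h y * k x y] integrable in [y] for
    every [x], not just almost every one. *)
Definition unit_kernel k := [/\ measurable_fun setT (fun z : T * T => k z.1 z.2),
  forall x y, 0 <= k x y,
  exists M, forall x y, `|k x y| <= M,
  forall y, (\int[mu]_x (k x y)%:E = 1)%E &
  forall x, (\int[mu]_y (k x y)%:E = 1)%E].

Lemma unit_kernel_measurable_r k x : unit_kernel k -> measurable_fun setT (k x).
Proof.
by move=> [mk _ _ _ _]; apply: (measurableT_comp mk (measurable_pair1 x)).
Qed.

Lemma unit_kernel_measurable_l k y : unit_kernel k -> measurable_fun setT (k ^~ y).
Proof.
by move=> [mk _ _ _ _]; apply: (measurableT_comp mk (measurable_pair2 y)).
Qed.

Lemma kconv_integrable k h x : unit_kernel k -> L1 h -> L1 (fun y => h y * k x y).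
Proof.
move=> uk ih; have [_ _ [M kM] _ _] := uk; have mh := L1_measurable ih.
have M0 : 0 <= M by rewrite (le_trans _ (kM x x)).
apply: (le_integrable measurableT _ _ (integrableZl measurableT M ih)).
- by apply/measurable_EFinP/measurable_funM => //; exact: unit_kernel_measurable_r.
- move=> y _; rewrite lee_fin/= normrM (normrM M) mulrC ler_pM// (ger0_norm M0).
  exact: kM.
Qed.

Lemma kconvD k h g x : unit_kernel k -> L1 h -> L1 g ->
  kconv k (fun y => h y + g y) x = kconv k h x + kconv k g x.
Proof.
move=> uk ih ig; rewrite /kconv -RintegralD//; try exact: kconv_integrable.
by apply: eq_Rintegral => y _; rewrite mulrDl.
Qed.

Lemma kconvZ k h a x : unit_kernel k -> L1 h ->
  kconv k (fun y => a * h y) x = a * kconv k h x.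
Proof.
move=> uk ih; rewrite /kconv -RintegralZl//; try exact: kconv_integrable.
by apply: eq_Rintegral => y _; rewrite mulrA.
Qed.

Lemma L1D h g : L1 h -> L1 g -> L1 (fun y => h y + g y).
Proof. by move=> ih ig; exact: (integrableD measurableT ih ig). Qed.

Lemma L1Z h a : L1 h -> L1 (fun y => a * h y).
Proof. by move=> ih; exact: (integrableZl measurableT a ih). Qed.

Lemma L1B h g : L1 h -> L1 g -> L1 (fun y => h y - g y).
Proof. by move=> ih ig; exact: (integrableB measurableT ih ig). Qed.

Lemma L1_indic (A : set T) : measurable A -> (mu A < +oo)%E -> L1 (\1_A : T -> R).
Proof.
move=> mA Aoo; apply/integrableP; split; first exact/measurable_EFinP.
rewrite (eq_integral (fun x => (\1_A x)%:E)); last first.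
  by move=> t _; rewrite gee0_abs// lee_fin.
by rewrite integral_indic// setIT.
Qed.

Definition dist1 h g : \bar R := (\int[mu]_x `|h x - g x|%:E)%E.

Lemma kconvB k h g x : unit_kernel k -> L1 h -> L1 g ->
  kconv k (fun y => h y - g y) x = kconv k h x - kconv k g x.
Proof.
move=> uk ih ig; rewrite /kconv -RintegralB//; try exact: kconv_integrable.
by apply: eq_Rintegral => y _; rewrite mulrBl.
Qed.

Let fubini_measurable k h : unit_kernel k -> L1 h ->
  measurable_fun setT (fun z : T * T => (h z.2 * k z.1 z.2)%:E).
Proof.
move=> [mk _ _ _ _] ih; apply/measurable_EFinP/measurable_funM => //.
by apply: measurableT_comp; [exact: L1_measurable|exact: measurable_snd].
Qed.

Let fubini_norm k h : unit_kernel k -> L1 h ->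
  (\int[mu]_y \int[mu]_x `|(h y * k x y)%:E| = \int[mu]_y `|h y|%:E)%E.
Proof.
move=> up ih; have [cp p0 bp p1 _] := up; apply: eq_integral => y _.
under eq_integral do rewrite abse_EFin normrM (ger0_norm (p0 _ _)) EFinM.
rewrite ge0_integralZl//=; last 2 first.
- exact/measurable_EFinP/unit_kernel_measurable_l.
- by move=> x _; rewrite lee_fin.
by rewrite p1 mule1.
Qed.

Lemma kconv_L1 k h : unit_kernel k -> L1 h ->
  L1 (kconv k h) /\ (\int[mu]_x `|kconv k h x|%:E <= \int[mu]_x `|h x|%:E)%E.
Proof.
move=> up ih; have [cp p0 bp p1 _] := up.
pose F (z : T * T) := (h z.2 * k z.1 z.2)%:E.
have mF : measurable_fun setT F by exact: fubini_measurable.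
have iF : (mu \x mu)%E.-integrable setT F.
  apply/(@integrable21ltyP _ _ _ _ _ mu mu F mF).
  have : (\int[mu]_y `|h y|%:E < +oo)%E by case/integrableP : ih.
  by rewrite -(fubini_norm up ih).
have FE x : (\int[mu]_y F (x, y) = (kconv k h x)%:E)%E.
  rewrite /kconv /Rintegral fineK//.
  by apply: integrable_fin_num => //; exact: kconv_integrable.
have := integrable_fubini_F iF; rewrite /fubini_F.
under eq_fun do rewrite FE; move=> iconv; split => //.
rewrite -(fubini_norm up ih).
rewrite -(fubini_tonelli (m1 := mu) (m2 := mu) (fun z => `|F z|%E))//; last first.
  exact: measurableT_comp.
apply: ge0_le_integral => //.
- by apply/measurable_EFinP/measurableT_comp => //; exact: L1_measurable.
- apply: (measurable_fun_fubini_tonelli_F (abse \o F)); last by move=> z; exact: abse_ge0.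
  exact: (measurableT_comp (f := abse) _ mF).
- move=> x _; rewrite -[leLHS]/(`|(kconv k h x)%:E|%E) -FE; apply: le_abse_integral => //.
  exact: measurable_int (kconv_integrable x up ih).
Qed.

Lemma kconv_mass k h : unit_kernel k -> L1 h -> (forall y, 0 <= h y) ->
  (\int[mu]_x (kconv k h x)%:E = \int[mu]_y (h y)%:E)%E.
Proof.
move=> up ih h0; have [cp p0 bp p1 _] := up.
pose F (z : T * T) := (h z.2 * k z.1 z.2)%:E.
have FE x : (\int[mu]_y F (x, y) = (kconv k h x)%:E)%E.
  rewrite /kconv /Rintegral fineK//.
  by apply: integrable_fin_num => //; exact: kconv_integrable.
under eq_integral do rewrite -FE.
rewrite (fubini_tonelli (m1 := mu) (m2 := mu) F)//; first last.
- by move=> z; rewrite lee_fin mulr_ge0.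
- exact: fubini_measurable.
transitivity (\int[mu]_y `|h y|%:E)%E; last first.
  by apply: eq_integral => y _; rewrite ger0_norm.
rewrite -(fubini_norm up ih); apply: eq_integral => y _; apply: eq_integral => x _.
by rewrite gee0_abs// lee_fin mulr_ge0.
Qed.

Lemma dist1_triangle h g f : L1 h -> L1 g -> L1 f ->
  (dist1 h f <= dist1 h g + dist1 g f)%E.
Proof.
move=> ih ig jf; have mh := L1_measurable ih; have mg := L1_measurable ig.
have mf := L1_measurable jf.
rewrite /dist1 -ge0_integralD//; last 2 first.
- by apply/measurable_EFinP/measurableT_comp => //; exact: measurable_funB.
- by apply/measurable_EFinP/measurableT_comp => //; exact: measurable_funB.
apply: ge0_le_integral => //.
- by apply/measurable_EFinP/measurableT_comp => //; exact: measurable_funB.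
- by apply: emeasurable_funD; apply/measurable_EFinP/measurableT_comp => //; exact: measurable_funB.
- by move=> x _; rewrite lee_fin ler_distD.
Qed.

Lemma dist1C h g : dist1 h g = dist1 g h.
Proof. by apply: eq_integral => x _; rewrite distrC. Qed.

Lemma dist1_kconv k h g : unit_kernel k -> L1 h -> L1 g ->
  (dist1 (kconv k h) (kconv k g) <= dist1 h g)%E.
Proof.
move=> up ih ig; have [_] := kconv_L1 up (L1B ih ig).
by under [leLHS]eq_integral do rewrite kconvB//.
Qed.

End kernel_operator.

Section approximate_identity.
Context {R : realType} {disp} {T : measurableType disp}.
Variable mu : {sigma_finite_measure set T -> \bar R}.
Local Notation L1 := (L1 mu).
Local Notation kconv := (kconv mu).
Local Notation dist1 := (dist1 mu).
Implicit Types (h g : T -> R).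
Variable K : R -> T -> T -> R.
Hypothesis K_unit : forall e, 0 < e -> unit_kernel mu (K e).
Variable O : set (set T).
Hypothesis O_measurable : forall U, O U -> measurable U.
Hypothesis O_regular : forall A e, measurable A -> 0 < e -> (mu A < +oo)%E ->
  exists U, [/\ O U, A `<=` U & (mu U <= mu A + e%:E)%E].
Hypothesis K_local : forall U x, O U -> U x ->
  \forall e \near 0^'+, forall y, ~ U y -> K e x y = 0.

(** [O] stands for the open sets. The class [good] is stable under linear combinations and, the
    averages being contractions, under [L^1] approximation; so it is enough that it contains the
    indicators of sets of [O] of finite measure. *)
Let good h := forall d, 0 < d ->
  \forall e \near 0^'+, (dist1 (kconv (K e) h) h <= d%:E)%E.

Let good_approx h : L1 h ->
  (forall d, 0 < d -> exists g, [/\ L1 g, good g & (dist1 h g <= d%:E)%E]) -> good h.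
Proof.
move=> ih happrox d d0; have d30 : 0 < d / 3 by rewrite divr_gt0.
have [g [ig gg hg]] := happrox _ d30.
near=> e; have e0 : 0 < e by [].
have up := K_unit e0.
have [[ich _] [icg _]] := (kconv_L1 up ih, kconv_L1 up ig).
apply: (le_trans (dist1_triangle ich icg ih)).
have -> : d%:E = ((d / 3)%:E + ((d / 3)%:E + (d / 3)%:E))%E.
  by rewrite -!EFinD; congr EFin; field.
apply: leeD; first exact: (le_trans (dist1_kconv up ih ig)).
apply: (le_trans (dist1_triangle icg ig ih)).
apply: leeD; last by rewrite dist1C.
by near: e; exact: gg.
Unshelve. all: by end_near. Qed.

Let goodD h g : L1 h -> L1 g -> good h -> good g -> good (fun x => h x + g x).
Proof.
move=> ih ig gh gg d d0; have d20 : 0 < d / 2 by rewrite divr_gt0.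
near=> e; have e0 : 0 < e by [].
have up := K_unit e0.
have [[ich _] [icg _]] := (kconv_L1 up ih, kconv_L1 up ig).
have mch := L1_measurable ich; have mcg := L1_measurable icg.
have mh := L1_measurable ih; have mg := L1_measurable ig.
have -> : d%:E = ((d / 2)%:E + (d / 2)%:E)%E by rewrite -EFinD -splitr.
apply: (@le_trans _ _ (dist1 (kconv (K e) h) h + dist1 (kconv (K e) g) g)%E); last first.
  by apply: leeD; near: e; [exact: gh|exact: gg].
rewrite /dist1 -ge0_integralD//; last 2 first.
- by apply/measurable_EFinP/measurableT_comp => //; exact: measurable_funB.
- by apply/measurable_EFinP/measurableT_comp => //; exact: measurable_funB.
under [leLHS]eq_integral do rewrite kconvD//.
apply: ge0_le_integral => //.
- apply/measurable_EFinP/measurableT_comp => //.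
  by apply: measurable_funB; exact: measurable_funD.
- by apply: emeasurable_funD; apply/measurable_EFinP/measurableT_comp => //; exact: measurable_funB.
- by move=> x _; rewrite lee_fin opprD addrACA ler_normD.
Unshelve. all: by end_near. Qed.

Let goodZ h a : L1 h -> good h -> good (fun x => a * h x).
Proof.
move=> ih gh d d0; have a0 : 0 < `|a| + 1 by rewrite ltr_wpDl.
have da0 : 0 < d / (`|a| + 1) by rewrite divr_gt0.
near=> e; have e0 : 0 < e by [].
have up := K_unit e0; have [ich _] := kconv_L1 up ih.
have mch := L1_measurable ich; have mh := L1_measurable ih.
rewrite /dist1; under eq_integral do rewrite kconvZ// -mulrBr normrM EFinM.
rewrite ge0_integralZl//=; last first.
  by apply/measurable_EFinP/measurableT_comp => //; exact: measurable_funB.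
apply: (@le_trans _ _ (`|a|%:E * (d / (`|a| + 1))%:E)%E).
  by rewrite lee_pmul// ?integral_ge0//; near: e; exact: gh.
by rewrite -EFinM lee_fin mulrA ler_pdivrMr// mulrC ler_pM2l// lerDl.
Unshelve. all: by end_near. Qed.

(* By conservation of mass, the distance from the average of [\1_U] to [\1_U] is
   twice the mass that leaves [U]; pointwise convergence is only needed in [U]. *)
Let good_open (U : set T) : O U -> (mu U < +oo)%E -> good (\1_U).
Proof.
move=> oU Uoo; have mU := O_measurable oU.
have iU : L1 (\1_U : T -> R) by exact: L1_indic.
suff : dist1 (kconv (K e) \1_U) \1_U @[e --> 0^'+] --> 0%E.
  move=> /fine_cvgP[H1 /cvgr0Pnorm_le H2] d d0.
  near=> e; rewrite -(@fineK _ (dist1 _ _)); last by near: e; exact: H1.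
  by rewrite lee_fin (le_trans (ler_norm _))//; near: e; exact: H2.
apply: (@cvg_at_right0_seq _ _ _ _ (fun _ _ => True)) => [k|s s0 s_cvg _].
  exact: nearW.
pose c k := kconv (K (s k)) (\1_U).
have ic k : L1 (c k) by have [] := kconv_L1 (K_unit (s0 k)) iU.
have c0 k x : 0 <= c k x.
  have [_ p0 _ _ _] := K_unit (s0 k).
  by apply: Rintegral_ge0 => y _; rewrite mulr_ge0.
have c1 k x : c k x <= 1.
  have uk := K_unit (s0 k); have [cp p0 bp p1 p2] := uk.
  rewrite -lee_fin /c /kconv /Rintegral fineK; last first.
    by apply: integrable_fin_num => //; exact: kconv_integrable.
  rewrite -(p2 x); apply: ge0_le_integral => //.
  - by move=> y _; rewrite lee_fin mulr_ge0.
  - exact: measurable_int (kconv_integrable x uk iU).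
  - exact/measurable_EFinP/unit_kernel_measurable_r.
  - move=> y _; rewrite lee_fin ler_piMl// indicE; by case: (_ \in _).
(* At a point of [U] the kernel eventually vanishes off [U], so the average is not only close to 1
   but equal to it. *)
have cU x : U x -> c k x @[k --> \oo] --> (1 : R).
  move=> Ux; apply: cvg_near_cst; near=> k.
  have [_ _ _ _ p2] := K_unit (s0 k).
  have xU : forall y, ~ U y -> K (s k) x y = 0.
    by near: k; have [r /= r0 rU] := K_local oU Ux; near=> k; apply: rU => //=;
      rewrite sub0r normrN gtr0_norm//; near: k; exact: (cvgr_lt 0).
  rewrite /c /kconv /Rintegral.
  suff -> : (\int[mu]_y (\1_U y * K (s k) x y)%:E = 1)%E by [].
  rewrite -(p2 x); apply: eq_integral => y _; rewrite indicE; have [Uy|Uy] := pselect (U y).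
    by rewrite mem_set ?mul1r.
  by rewrite xU// mulr0.
have iUc k : L1 (fun x => c k x * \1_U x).
  apply: (le_integrable measurableT _ _ (ic k)) => //.
    by apply/measurable_EFinP/measurable_funM => //; exact: L1_measurable.
  move=> x _; rewrite lee_fin normrM ler_piMr// indicE.
  by case: (_ \in _); rewrite ?normr1 ?normr0.
(* As [0 <= c k x <= 1], the integrand equals [c + 1_U - 2 c 1_U], and its first two terms both have
   integral [mu U]. *)
have dE k : dist1 (c k) \1_U =
    (2%:E * (mu U - \int[mu]_x (c k x * \1_U x)%:E))%E.
  have U2 : (\int[mu]_x (\1_U x)%:E = mu U)%E by rewrite integral_indic// setIT.
  rewrite /dist1 (_ : (\int[mu]_x _)%E =
     (\int[mu]_x (c k x + (\1_U x - 2 * (c k x * \1_U x)))%:E)%E); last first.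
    apply: eq_integral => x _; congr EFin; rewrite indicE; case: (_ \in _).
      by rewrite ler0_norm ?subr_le0// mulr1n; ring.
    by rewrite mulr0n subr0 ger0_norm//; ring.
  rewrite (integralD_EFin measurableT (ic k) (L1B iU (L1Z 2 (iUc k)))).
  rewrite (integralB_EFin measurableT iU (L1Z 2 (iUc k))).
  have := integralZl measurableT (iUc k) 2; rewrite /comp/=.
  under eq_integral do rewrite -EFinM.
  move=> ->; have := kconv_mass (K_unit (s0 k)) iU (fun y => _); rewrite -/(c k) => ->; last first.
    by move=> y; rewrite indicE.
  rewrite U2.
  have : (\int[mu]_x (c k x * \1_U x)%:E)%E \is a fin_num by exact: integrable_fin_num (iUc k).
  have : mu U \is a fin_num by rewrite ge0_fin_numE.
  move: (mu U) (\int[mu]_x _)%E => [a| |] [b| |]// _ _.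
  by rewrite -!(EFinM, EFinN, EFinD); congr EFin; ring.
have dc : (\int[mu]_x (c k x * \1_U x)%:E)%E @[k --> \oo] --> (\int[mu]_x (\1_U x)%:E)%E.
  have [] := @dominated_convergence _ T R mu setT measurableT
    (fun k x => (c k x * \1_U x)%:E) (fun x => (\1_U x)%:E) (fun x => (\1_U x)%:E).
  - by move=> k; exact: measurable_int (iUc k).
  - exact: measurable_int iU.
  - apply: aeW => x _; have H : c k x * \1_U x @[k --> \oo] --> (\1_U x : R).
      rewrite indicE; case: (pselect (U x)) => Ux.
        have -> : (x \in U)%:R = 1 :> R by rewrite mem_set.
        by under eq_cvg do rewrite mulr1; exact: cU.
      have -> : (x \in U)%:R = 0 :> R by rewrite memNset.
      by under eq_cvg do rewrite mulr0; exact: cvg_cst.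
    by apply: cvg_EFin; [exact: nearW|exact: H].
  - exact: iU.
  - apply: aeW => x k _; rewrite lee_fin indicE normrM ger0_norm//.
    by case: (_ \in _); rewrite ?normr1 ?mulr1// normr0 mulr0.
  - by [].
move: dc; rewrite (_ : (\int[mu]_x (\1_U x)%:E)%E = mu U); last by rewrite integral_indic// setIT.
move=> dc; under eq_cvg do rewrite dE.
have fU : mu U \is a fin_num by rewrite ge0_fin_numE.
rewrite (_ : 0%E = (2%:E * (mu U - mu U))%E); last by rewrite subee// mule0.
apply: cvgeZl => //; apply: cvgeB => //; last exact: cvg_cst.
by move: fU; case: (mu U).
Unshelve. all: by end_near. Qed.

Let good_indic (A : set T) : measurable A -> (mu A < +oo)%E -> good (\1_A).
Proof.
move=> mA Aoo; have iA := L1_indic mA Aoo.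
apply: good_approx => // d d0.
have [U [oU AU UA]] := O_regular mA d0 Aoo.
have fA : mu A \is a fin_num by rewrite ge0_fin_numE.
have Uoo : (mu U < +oo)%E.
  by apply: (le_lt_trans UA); rewrite -(fineK fA) -EFinD ltry.
have mU := O_measurable oU.
exists (\1_U); split; [exact: L1_indic|exact: good_open|].
rewrite dist1C /dist1 (_ : (\int[mu]_x _)%E = (\int[mu]_x (\1_(U `\` A) x)%:E)%E); last first.
  apply: eq_integral => x _; congr EFin; rewrite !indicE in_setD.
  have [xA|xA] := boolP (x \in A).
    by rewrite (mem_set (AU _ (set_mem xA))) subrr normr0.
  by case: (x \in U); rewrite /= subr0 ?normr1 ?normr0.
rewrite integral_indic ?setIT//; last exact: measurableD.
rewrite measureD// setIidr// leeBlDl//.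
Qed.

Let L1_sum (I : Type) (r : seq I) (F : I -> T -> R) :
  (forall i, L1 (F i)) -> L1 (fun x => \sum_(i <- r) F i x).
Proof.
move=> iF; rewrite /L1; have := integrable_sum measurableT r (P := xpredT) (fun i _ => iF i).
by congr (_.-integrable _ _); apply/funext => x; rewrite /= -sumEFin.
Qed.

Let good_sum (I : Type) (r : seq I) (F : I -> T -> R) :
  (forall i, L1 (F i)) -> (forall i, good (F i)) -> good (fun x => \sum_(i <- r) F i x).
Proof.
move=> iF gF; elim: r => [|i r IH].
  move=> d d0; near=> e; have e0 : 0 < e by [].
  rewrite /dist1; under eq_integral do rewrite big_nil.
  rewrite integral0_eq ?lee_fin ?ltW// => x _.
  rewrite /kconv; under eq_Rintegral do rewrite big_nil mul0r.
  by rewrite /Rintegral integral0 /= subr0 normr0.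
have -> : (fun x => \sum_(j <- i :: r) F j x) = (fun x => F i x + \sum_(j <- r) F j x).
  by apply/funext => x; rewrite big_cons.
by apply: goodD => //; exact: L1_sum.
Unshelve. all: by end_near. Qed.

Import HBSimple.

Lemma kconv_cvg_L1 h : L1 h -> dist1 (kconv (K e) h) h @[e --> 0^'+] --> 0%E.
Proof.
move=> ih; suff gh : good h.
  apply/fine_cvgP; split.
    near=> e; rewrite ge0_fin_numE ?integral_ge0//.
    apply: (@le_lt_trans _ _ 1%:E); last exact: ltry.
    by near: e; exact: gh.
  apply/cvgr0Pnorm_le => d d0; near=> e.
  rewrite ger0_norm ?fine_ge0 ?integral_ge0//.
  have de : (dist1 (kconv (K e) h) h <= d%:E)%E by near: e; exact: gh.
  rewrite -lee_fin fineK// ge0_fin_numE ?integral_ge0//.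
  by apply: (le_lt_trans de); exact: ltry.
apply: good_approx => // d d0.
have [g [ig _ gh]] := approximation_sfun_integrable measurableT ih.
have [N _ /(_ N (leqnn N)) gN] : \forall N \near \oo, (dist1 h (g N) <= d%:E)%E.
  move/fine_cvgP : gh => [H1 /cvgr0Pnorm_le H2].
  near=> k; rewrite -(@fineK _ (dist1 _ _)); last by near: k; exact: H1.
  by rewrite lee_fin (le_trans (ler_norm _))//; near: k; exact: H2.
exists (g N); split; [exact: ig| |exact: gN].
have mg y : measurable (g N @^-1` [set y]) by exact: measurable_sfunP.
have -> : (g N : T -> R) = (fun x => \sum_(y \in range (g N)) (y * \1_(g N @^-1` [set y]) x)).
  by apply/funext => x; exact: fimfunE.
under eq_fun do rewrite fsbig_finite//=.
(* Integrability of the simple function forces its nonzero levels to have finite measure. The level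
   0 may have infinite measure, but its term is the zero function and is treated apart. *)
have gy y : y != 0 -> (mu (g N @^-1` [set y]) < +oo)%E.
  move=> y0.
  have y00 : 0 < `|y| by rewrite normr_gt0.
  have : (\int[mu]_(x in g N @^-1` [set y]) `|y|%:E < +oo)%E.
    have /integrableP[_] := integrableS measurableT (mg y) (@subsetT _ _) (ig N).
    by under eq_integral => x /set_mem /= -> do [].
  rewrite integral_cst// => yoo; have {yoo} : (`|y|%:E * mu (g N @^-1` [set y]) < +oo)%E by [].
  rewrite !ltNge !leye_eq; apply: contra => /eqP ->.
  by rewrite gt0_muley// lte_fin.
have L1y y : L1 (fun x => y * \1_(g N @^-1` [set y]) x).
  have [->|y0] := eqVneq y 0.
    by rewrite (_ : (fun _ => _) = fun=> 0); [exact: integrable0|apply/funext => x; rewrite mul0r].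
  by apply/L1Z/L1_indic => //; exact: gy.
apply: (@good_sum _ _ (fun y x => y * \1_(g N @^-1` [set y]) x)) => // y; have [->|y0] := eqVneq y 0.
  have L0 : L1 (fun=> 0 : R) by exact: integrable0.
  move=> e e0; near=> t.
  rewrite /dist1 integral0_eq ?lee_fin ?ltW// => x _.
  rewrite mul0r /kconv; under eq_Rintegral do rewrite !mul0r.
  by rewrite /Rintegral integral0 /= subr0 normr0.
by apply: goodZ; [apply: L1_indic|apply: good_indic] => //; exact: gy.
Unshelve. all: by end_near. Qed.

End approximate_identity.

(** * Euclidean norm and directional derivatives *)

Section enorm.
Context {R : realType} {m k : nat}.
Implicit Types A B : 'M[R]_(m, k).

Lemma enorm_ge0 A : 0 <= enorm A. Proof. exact: sqrtr_ge0. Qed.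

Lemma sum_sqr_ge0 A : 0 <= \sum_i \sum_j A i j ^+ 2.
Proof. by rewrite sumr_ge0// => i _; rewrite sumr_ge0// => j _; rewrite sqr_ge0. Qed.

Lemma enorm_sqr A : enorm A ^+ 2 = \sum_i \sum_j A i j ^+ 2.
Proof. by rewrite sqr_sqrtr// sum_sqr_ge0. Qed.

Lemma enormZ a A : enorm (a *: A) = `|a| * enorm A.
Proof.
rewrite /enorm -sqrtr_sqr -sqrtrM ?sqr_ge0//; congr Num.sqrt.
rewrite mulr_sumr; apply: eq_bigr => i _; rewrite mulr_sumr; apply: eq_bigr => j _.
by rewrite mxE exprMn.
Qed.

Lemma enormN A : enorm (- A) = enorm A.
Proof. by rewrite -scaleN1r enormZ normrN1 mul1r. Qed.

Lemma enormC A B : enorm (A - B) = enorm (B - A).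
Proof. by rewrite -enormN opprB. Qed.

Lemma enorm0 : enorm (0 : 'M[R]_(m, k)) = 0.
Proof. by rewrite -(scale0r 0) enormZ normr0 mul0r. Qed.

Lemma coord_le_enorm A i j : `|A i j| <= enorm A.
Proof.
rewrite -sqrtr_sqr ler_wsqrtr// (bigD1 i)//= (bigD1 j)//= -addrA lerDl.
rewrite addr_ge0// ?sumr_ge0// => *; last by rewrite sumr_ge0// => *; rewrite sqr_ge0.
by rewrite sqr_ge0.
Qed.

Lemma norm_le_enorm A : `|A| <= enorm A.
Proof.
rewrite [leLHS]mx_normrE; apply: bigmax_le => [|[i j] _]; first exact: enorm_ge0.
exact: coord_le_enorm.
Qed.

Lemma enorm_le_sum A : enorm A <= \sum_i \sum_j `|A i j|.
Proof.
have S0 : 0 <= \sum_i \sum_j `|A i j| by rewrite sumr_ge0// => i _; rewrite sumr_ge0.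
have sum_sqr (I : finType) (F : I -> R) : (forall i, 0 <= F i) ->
    \sum_i F i ^+ 2 <= (\sum_i F i) ^+ 2.
  move=> F0; rewrite [leRHS]expr2 mulr_suml ler_sum// => i _.
  by rewrite expr2 ler_wpM2l// (bigD1 i)//= lerDl sumr_ge0.
rewrite -[leRHS](ger0_norm S0) -sqrtr_sqr ler_wsqrtr//.
apply: le_trans (sum_sqr _ (fun i => \sum_j `|A i j|) _); last by move=> i; rewrite sumr_ge0.
apply: ler_sum => i _; apply: le_trans (sum_sqr _ (fun j => `|A i j|) _); last by [].
by apply: ler_sum => j _; rewrite real_normK ?num_real.
Qed.

Lemma enorm_sub_sqr A B : enorm (A - B) ^+ 2 <= 2 * (enorm A ^+ 2 + enorm B ^+ 2).
Proof.
rewrite !enorm_sqr -big_split/= mulr_sumr ler_sum// => i _.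
rewrite -big_split/= mulr_sumr ler_sum// => j _.
rewrite !mxE; have := sqr_ge0 (A i j + B i j); nra.
Qed.

(** The difference is at most twice the larger norm, and the power of a maximum is at most the sum
    of the powers. *)
Lemma enorm_sub_powR A B p : 0 <= p ->
  enorm (A - B) `^ p <= 2 `^ p * (enorm A `^ p + enorm B `^ p).
Proof.
move=> p0; set c := Num.max (enorm A) (enorm B).
have c0 : 0 <= c by rewrite le_max enorm_ge0.
have Ac : enorm A <= c by rewrite le_max lexx.
have Bc : enorm B <= c by rewrite le_max lexx orbT.
have ABc : enorm (A - B) <= 2 * c.
  rewrite -(@ler_pXn2r _ 2)// ?nnegrE ?enorm_ge0 ?mulr_ge0//.
  apply: (le_trans (enorm_sub_sqr A B)).
  have : enorm A ^+ 2 <= c ^+ 2 by rewrite ler_pXn2r ?nnegrE ?enorm_ge0.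
  have : enorm B ^+ 2 <= c ^+ 2 by rewrite ler_pXn2r ?nnegrE ?enorm_ge0.
  by rewrite exprMn; lra.
apply: (@le_trans _ _ ((2 * c) `^ p)); first by rewrite ge0_ler_powR ?nnegrE ?enorm_ge0 ?mulr_ge0.
rewrite powRM// ler_wpM2l ?powR_ge0//.
by rewrite /c /Order.max; case: ifP => _; rewrite ?lerDl ?lerDr powR_ge0.
Qed.

Lemma enorm_continuous : continuous (@enorm R m k).
Proof.
have cS : continuous (fun A : 'M[R]_(m, k) => \sum_i \sum_j A i j ^+ 2).
  apply: continuous_big => [|i _]; first exact: add_continuous.
  apply: continuous_big => [|j _ A]; first exact: add_continuous.
  exact: (continuous_comp (@coord_continuous _ _ _ i j A) (@exprn_continuous _ 2 _)).
by move=> A; exact: (continuous_comp (cS A) (@sqrt_continuous _ _)).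
Qed.

End enorm.

Section euclidean_ball.
Context {R : realType} {n : nat}.
Implicit Types x y : 'rV[R]_n.

Lemma closure_eball_le x r : closure (eball x r) `<=` [set y | enorm (y - x) <= r].
Proof.
have /closure_id -> : closed [set y | enorm (y - x) <= r].
  have -> : [set y | enorm (y - x) <= r] = (fun y => enorm (y - x)) @^-1` [set t | t <= r] by [].
  apply: closed_comp => [y _|]; last exact: closed_le.
  have h : (z - x) @[z --> y] --> y - x.
    by apply: (@cvgB _ _ _ (nbhs y) (nbhs_filter y)); [exact: cvg_id|exact: cvg_cst].
  exact: (continuous_comp h (@enorm_continuous _ _ _ _)).
by apply: closureS => y; exact: ltW.
Qed.

Lemma eball_open x r : open (eball x r).
Proof.
have -> : eball x r = (fun y => enorm (y - x)) @^-1` [set t | t < r] by [].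
apply: open_comp => [y _|]; last exact: open_lt.
have h : (z - x) @[z --> y] --> y - x.
  by apply: (@cvgB _ _ _ (nbhs y) (nbhs_filter y)); [exact: cvg_id|exact: cvg_cst].
exact: (continuous_comp h (@enorm_continuous _ _ _ _)).
Qed.

Lemma closure_eball_compact x r : compact (closure (eball x r)).
Proof.
apply: bounded_closed_compact; last exact: closed_closure.
exists (`|x| + r); split; first exact: num_real.
move=> M rM y /closure_eball_le/= yx; apply: (le_trans _ (ltW rM)).
rewrite -[y](subrK x) (le_trans (ler_normD _ _))// addrC lerD2l.
exact: le_trans (norm_le_enorm _) yx.
Qed.

End euclidean_ball.

(** A Lebesgue number argument: half the radius available at [x] serves all points near [x], and
    compactness makes the choice uniform. *)
Lemma compact_sub_open_near {R : realType} {V : normedModType R} (K U : set V) :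
  compact K -> open U -> K `<=` U ->
  \forall e \near (0 : R)^'+, forall x, K x -> ball x e `<=` U.
Proof.
move=> cK oU KU.
have := (compact_near_coveringP K).1 cK R (0^'+) (fun e x => ball x e `<=` U) _.
apply => x Kx; have /nbhs_ballP[r /= r0 rU] : nbhs x U by apply: open_nbhs_nbhs; split => //; exact: KU.
have r20 : 0 < r / 2 by rewrite divr_gt0.
near=> x' e; have xx' : ball x (r / 2) x' by near: x'; exact: nbhsx_ballx.
have er : e <= r / 2 by near: e; exact: nbhs_right_le.
by move=> y x'y; apply: rU; apply: (ball_split xx'); exact: le_ball x'y.
Unshelve. all: by end_near. Qed.

Section line_derivative.
Context {R : realType} {n : nat}.
Implicit Types (g : 'rV[R]_n -> R) (x v : 'rV[R]_n).

Let line_quotient g x v s :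
  (fun h : R => h^-1 *: ((fun s => g (x + s *: v)) (h *: (1 : R) + s) - g (x + s *: v))) =
  (fun h : R => h^-1 *: (g (h *: v + (x + s *: v)) - g (x + s *: v))).
Proof.
apply/funext => h; congr (_ *: (g _ - _)).
by rewrite scalerDl -scalerA scale1r addrCA.
Qed.

(** Restriction to a line turns a directional derivative into a one-variable one, to which the mean
    value theorem and differentiation under the integral apply. *)
Lemma derivable_lineE g x v (s : R) :
  derivable (fun s : R => g (x + s *: v)) s 1 = derivable g (x + s *: v) v.
Proof. by rewrite /derivable line_quotient. Qed.

Lemma derive_line g x v (s : R) :
  'D_1 (fun s : R => g (x + s *: v)) s = 'D_v g (x + s *: v).
Proof. by rewrite /derive line_quotient. Qed.

Lemma directional_MVT g v M x (t : R) : (forall x, derivable g x v) ->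
  (forall x, `|'D_v g x| <= M) -> `|g (x + t *: v) - g x| <= M * `|t|.
Proof.
move=> dg gM; pose f s := g (x + s *: v).
have df (s : R) : is_derive s (1 : R) f ('D_v g (x + s *: v)).
  by apply: DeriveDef; [rewrite derivable_lineE|exact: derive_line].
have cf a b : {within `[a, b], continuous f}.
  by apply: derivable_within_continuous => s _; rewrite derivable_lineE.
have f0 : f 0 = g x by rewrite /f scale0r addr0.
rewrite -/(f t) -f0; have [t0|t0] := leP 0 t.
  have [c _ ->] := MVT_segment t0 (fun s _ => df s) (@cf 0 t).
  by rewrite subr0 normrM ler_wpM2r.
have [c _] := MVT_segment (ltW t0) (fun s _ => df s) (@cf t 0).
by rewrite distrC => ->; rewrite sub0r normrM normrN ler_wpM2r.
Qed.

End line_derivative.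

(** * Mollification kernels *)

Lemma cvg_dnbhs0_scale {R : realType} (b : R) : b != 0 ->
  (b * h) @[h --> (0 : R)^'] --> (0 : R)^'.
Proof.
move=> b0 A [e /= e0 eA]; have nb0 : 0 < `|b| by rewrite normr_gt0.
exists (e / `|b|) => /=; first by rewrite divr_gt0.
move=> h /=; rewrite sub0r normrN => he h0; apply: eA; last by rewrite mulf_neq0.
by rewrite /= sub0r normrN normrM mulrC -ltr_pdivlMr.
Qed.

Section reflected_dilation.
Context {R : realType} {n : nat}.
Implicit Types (g : 'rV[R]_n -> R) (x y v : 'rV[R]_n).

(** With [c = e ^- n] and [a = e^-1] this is the test function [phi_e (x - y)] in the variable [y].
    The opposite [a] describes the same kernel as a function of its other variable, so one
    computation covers both. *)
Definition dilate_refl (c a : R) x g y : R := c * g (a *: (x - y)).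

Let quotient c a x g y v : a != 0 ->
  (fun h : R => h^-1 *: (dilate_refl c a x g (h *: v + y) - dilate_refl c a x g y)) =
  (fun k : R => (- a * c) * (k^-1 *: (g (k *: v + a *: (x - y)) - g (a *: (x - y))))) \o
    (fun h => - a * h).
Proof.
move=> a0; apply/funext => h /=; rewrite /dilate_refl.
have -> : a *: (x - (h *: v + y)) = (- a * h) *: v + a *: (x - y).
  by apply/matrixP => i j; rewrite !mxE; ring.
rewrite -mulrBr /GRing.scale/=; have [->|h0] := eqVneq h 0.
  by rewrite mulr0 invr0 !mul0r mulr0.
by field; rewrite h0.
Qed.

Lemma is_derive_dilate_refl c a x g y v : a != 0 -> derivable g (a *: (x - y)) v ->
  is_derive y v (dilate_refl c a x g) (- a * c * 'D_v g (a *: (x - y))).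
Proof.
move=> a0 dg; have Na0 : - a != 0 by rewrite oppr_eq0.
have H : (fun h : R => h^-1 *: (dilate_refl c a x g (h *: v + y) - dilate_refl c a x g y))
    @ 0^' --> - a * c * 'D_v g (a *: (x - y)).
  rewrite quotient//; apply: (cvg_comp _ _ (cvg_dnbhs0_scale Na0)).
  by apply: cvgMl_tmp; exact: dg.
by apply: DeriveDef; [apply/cvg_ex; eexists; exact: H|exact: cvg_lim H].
Qed.

Lemma foldr_partial_dilate_refl c a x g (s : seq 'I_n) : a != 0 -> smooth g ->
  foldr (@partial R n) (dilate_refl c a x g) s =
  dilate_refl ((- a) ^+ size s * c) a x (foldr (@partial R n) g s).
Proof.
move=> a0 sg; elim: s => [|j s IH] /=; first by rewrite mul1r.
rewrite IH; apply/funext => y; rewrite {1}/partial.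
have [_ /(_ j (a *: (x - y))) dg] := sg s.
have [_ ->] := is_derive_dilate_refl ((- a) ^+ size s * c) a0 dg.
by rewrite /dilate_refl exprS !mulrA.
Qed.

Lemma continuous_dilate_refl c a x g : continuous g -> continuous (dilate_refl c a x g).
Proof.
move=> cg y.
have h : (a *: (x - z)) @[z --> y] --> a *: (x - y).
  apply: (@cvgZr _ _ _ _ (nbhs_filter y)).
  by apply: (@cvgB _ _ _ (nbhs y) (nbhs_filter y)); [exact: cvg_cst|exact: cvg_id].
apply: (@cvgMr _ _ (nbhs y) (nbhs_filter y)).
exact: (continuous_comp h (cg _)).
Qed.

Lemma smooth_dilate_refl c a x g : a != 0 -> smooth g -> smooth (dilate_refl c a x g).
Proof.
move=> a0 sg s; rewrite foldr_partial_dilate_refl//; have [cg dg] := sg s.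
split=> [|j y]; last first.
  by have [] := is_derive_dilate_refl ((- a) ^+ size s * c) a0 (dg j (a *: (x - y))).
exact: continuous_dilate_refl.
Qed.

End reflected_dilation.

Section kernel.
Context {R : realType} {n : nat}.
Implicit Types (g phi : 'rV[R]_n -> R).

Lemma bounded_of_support g : continuous g -> (forall t, 1 < enorm t -> g t = 0) ->
  exists M, forall t, `|g t| <= M.
Proof.
move=> cg g0.
have /compact_bounded[M [Mr gM]] : compact (g @` closure (eball 0 2)).
  by apply: continuous_compact; [exact: continuous_subspaceT|exact: closure_eball_compact].
exists (Num.max 0 (M + 1)) => t; rewrite le_max.
have [t1|t1] := leP (enorm t) 1; last by rewrite g0// normr0 lexx.
apply/orP; right; apply: (gM (M + 1)); first by rewrite ltrDl.
exists t => //; apply: subset_closure; rewrite /eball/= subr0; lra.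
Qed.

Lemma kernel_support_gt phi t : supp phi `<=` closure (eball 0 1) -> 1 < enorm t -> phi t = 0.
Proof.
move=> sphi; apply: contra_ltP => /eqP phit.
have /sphi/closure_eball_le/= : supp phi t by exact: subset_closure.
by rewrite subr0.
Qed.

Lemma partial_support_gt (j : 'I_n) g t : (forall t, 1 < enorm t -> g t = 0) ->
  1 < enorm t -> partial j g t = 0.
Proof.
move=> g0 t1; rewrite /partial (@near_eq_derive _ _ _ g (cst 0)) ?derive_cst//.
have -> : (\near t, g t = cst 0 t) = nbhs t [set t | g t = 0] by [].
apply: (@filterS _ (nbhs t) _ [set s | 1 < enorm s]) => [s /= s1|]; first exact: g0.
apply: open_nbhs_nbhs; split => //.
apply: (@open_comp _ _ (@enorm R 1 n) [set r | 1 < r]) => [y _|]; last exact: open_gt.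
exact: enorm_continuous.
Qed.

(** The support condition only gives vanishing outside the closed unit ball; continuity along the
    ray through [t] adds the sphere. The kernel then vanishes outside the open ball over which
    [mollify] integrates. *)
Lemma kernel_support_ge phi t : mollification_kernel phi -> 1 <= enorm t -> phi t = 0.
Proof.
move=> [sphi supphi _ _ _]; rewrite le_eqVlt => /orP[/eqP t1|]; last exact: kernel_support_gt.
have [cphi _] := sphi [::].
have h : (s *: t) @[s --> (1 : R)^'+] --> t.
  apply: cvg_at_right_filter; rewrite -[X in _ --> X]scale1r.
  by apply: cvgZl; exact: cvg_id.
have H : phi (s *: t) @[s --> (1 : R)^'+] --> phi t.
  exact: (cvg_comp _ _ h (cphi t)).
have H0 : phi (s *: t) @[s --> (1 : R)^'+] --> 0.
  apply: cvg_near_cst; near=> s; apply: (kernel_support_gt supphi).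
  have s1 : 1 < s by [].
  by rewrite enormZ -t1 mulr1 gtr0_norm// (lt_trans _ s1).
exact: (cvg_unique _ H H0).
Unshelve. all: by end_near. Qed.

Definition moll_kernel phi (e : R) (x y : 'rV[R]_n) : R := e ^- n * phi (e^-1 *: (x - y)).

Lemma moll_kernelE phi e x : moll_kernel phi e x = dilate_refl (e ^- n) e^-1 x phi.
Proof. by []. Qed.

Lemma moll_kernel_eq0 phi e x y : mollification_kernel phi -> 0 < e ->
  e <= enorm (x - y) -> moll_kernel phi e x y = 0.
Proof.
move=> kphi e0 exy; rewrite /moll_kernel kernel_support_ge ?mulr0//.
by rewrite enormZ gtr0_norm ?invr_gt0// ler_pdivlMl// mulr1.
Qed.

Lemma moll_kernel_sym phi e x y : mollification_kernel phi ->
  moll_kernel phi e x y = moll_kernel phi e y x.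
Proof.
move=> [_ _ _ sym _]; congr (_ * _); apply: sym.
by rewrite !enormZ enormC.
Qed.

(** The mass in one variable is a change of variables; radial symmetry exchanges the variables and
    gives the other. *)
Lemma moll_kernel_unit phi e : mollification_kernel phi -> 0 < e ->
  unit_kernel (leb R n) (moll_kernel phi e).
Proof.
move=> kphi e0; have [sphi supphi phi0 _ phi1] := kphi.
have [cphi _] := sphi [::].
have en0 : 0 <= e ^- n by rewrite invr_ge0 exprn_ge0// ltW.
have mass y : (\int[leb R n]_x (moll_kernel phi e x y)%:E = 1)%E.
  have mphi : measurable_fun [set: lebType R n] (fun t => (phi t)%:E).
    by apply/measurable_EFinP/leb_continuous_measurable.
  have ei0 : 0 < e^-1 by rewrite invr_gt0.
  have phi0' t : (0 <= (phi t)%:E)%E by rewrite lee_fin.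
  have H := ge0_integral_affine (- (e^-1 *: y)) ei0 mphi phi0'.
  transitivity ((e ^- n)%:E * \int[leb R n]_x (phi (affine e^-1 (- (e^-1 *: y)) x))%:E)%E.
    rewrite -ge0_integralZl//.
    - by apply: eq_integral => x _; rewrite /moll_kernel EFinM /affine scalerBr.
    - apply: (measurableT_comp mphi); exact: measurable_affine.
  rewrite H phi1 mule1 -EFinM exprVn invrK mulVf// gt_eqF// exprn_gt0//.
split => //.
- apply: measurable_funM => //.
  apply: (@measurable_continuous_comp _ _ _ _ _ _
    (fun z : lebType R n * lebType R n => e^-1 *: ((z.1 : 'rV[R]_n) - z.2))) => // i j.
  rewrite (_ : (fun z : lebType R n * lebType R n => (e^-1 *: ((z.1 : 'rV[R]_n) - z.2)) i j) =
    (fun z => e^-1 * ((fun x : 'rV[R]_n => x i j) z.1 - (fun x : 'rV[R]_n => x i j) z.2))).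
    apply: measurable_funM => //; apply: measurable_funB.
      exact: (measurableT_comp (coord_measurable_rV i j measurableT) measurable_fst).
    exact: (measurableT_comp (coord_measurable_rV i j measurableT) measurable_snd).
  by apply/funext => z; rewrite !mxE.
- by move=> x y; rewrite mulr_ge0.
- have [M phiM] := bounded_of_support cphi (fun t => kernel_support_gt supphi).
  exists (e ^- n * M) => x y; rewrite normrM (ger0_norm en0) ler_wpM2l//.
- move=> x; rewrite -[RHS](mass x); apply: eq_integral => y _.
  by rewrite moll_kernel_sym.
Qed.

Lemma moll_kernel_local phi (U : set 'rV[R]_n) x : mollification_kernel phi ->
  open U -> U x -> \forall e \near 0^'+, forall y, ~ U y -> moll_kernel phi e x y = 0.
Proof.
move=> kphi oU Ux.
have /nbhs_ballP[r /= r0 rU] : nbhs x U by exact: open_nbhs_nbhs.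
near=> e => y Uy; apply: moll_kernel_eq0 => //.
apply: (le_trans _ (norm_le_enorm _)); rewrite leNgt; apply/negP => xye; apply: Uy.
apply: rU; rewrite mx_norm_ball /ball_/=; apply: (lt_le_trans xye).
near: e; exact: nbhs_right_le.
Unshelve. all: by end_near. Qed.

Lemma moll_cvg_L1 phi (h : 'rV[R]_n -> R) : mollification_kernel phi -> L1 (leb R n) h ->
  dist1 (leb R n) (kconv (leb R n) (moll_kernel phi e) h) h @[e --> 0^'+] --> 0%E.
Proof.
move=> kphi ih.
refine (@kconv_cvg_L1 R _ (lebType R n) (leb R n) (moll_kernel phi) _
  (@open 'rV[R]_n) _ _ _ h ih).
- by move=> e e0; exact: moll_kernel_unit.
- by move=> U; exact: leb_open_measurable.
- by move=> A e _; exact: leb_outer_regular.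
- by move=> U x; exact: moll_kernel_local.
Qed.

End kernel.

Lemma L1_mul_bounded {R : realType} {d} {T : measurableType d}
    (mu : {sigma_finite_measure set T -> \bar R}) (h k : T -> R) M :
  L1 mu h -> measurable_fun setT k -> (forall y, `|k y| <= M) ->
  L1 mu (fun y => h y * k y).
Proof.
move=> ih mk kM; have mh : measurable_fun setT h by move/measurable_int : ih => /measurable_EFinP.
(* [0 <= M] is read off at a point; without any point, all functions agree. *)
have [y0|no] := pselect (exists y : T, True); last first.
  apply: (@eq_integrable _ _ _ _ setT measurableT (EFin \o h)) => // y _.
  by exfalso; apply: no; exists y.
have M0 : 0 <= M by case: y0 => y _; rewrite (le_trans _ (kM y)).
apply: (le_integrable measurableT _ _ (integrableZl measurableT M ih)).
- exact/measurable_EFinP/measurable_funM.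
- by move=> y _; rewrite lee_fin/= normrM (normrM M) mulrC ler_pM// (ger0_norm M0).
Qed.

Lemma is_derive_Rintegral_mul {R : realType} {d} {T : measurableType d}
    (mu : {sigma_finite_measure set T -> \bar R}) (h : T -> R) (k k' : R -> T -> R) M M' :
  L1 mu h -> (forall t, measurable_fun setT (k t)) -> (forall t y, `|k t y| <= M) ->
  (forall t y, is_derive t (1 : R) (k ^~ y) (k' t y)) -> (forall t y, `|k' t y| <= M') ->
  is_derive (0 : R) (1 : R) (fun t => \int[mu]_y (h y * k t y)) (\int[mu]_y (h y * k' 0 y)).
Proof.
move=> ih mk kM dk k'M'.
have dhk (t : R) y : is_derive t (1 : R) (fun t => h y * k t y) (h y * k' t y).
  have := @is_deriveZ _ _ _ (k ^~ y) (h y) t (1 : R) _ (dk t y); exact.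
pose f t y := h y * k t y.
have I0 : `]-1, 1[%classic (0 : R) by rewrite /= in_itv/=; lra.
have intf t : `]-1, 1[%classic t -> mu.-integrable setT (EFin \o f t).
  by move=> _; exact: (L1_mul_bounded ih (mk t) (kM t)).
have derf t y : `]-1, 1[%classic t -> setT y -> derivable (f ^~ y) t 1.
  by move=> _ _; have [] := dhk t y.
have d1f t y : partial1of2 f t y = h y * k' t y.
  by rewrite partial1of2E; have [_] := dhk t y.
have G0 y : 0 <= `|h y| * M'.
  by rewrite mulr_ge0// (le_trans _ (k'M' 0 y)).
have iG : mu.-integrable setT (EFin \o (fun y => `|h y| * M')).
  have := integrableZr measurableT M' (integrable_norm ih); exact.
have Gub t y : `]-1, 1[%classic t -> setT y -> `|partial1of2 f t y| <= `|h y| * M'.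
  by move=> _ _; rewrite d1f normrM ler_wpM2l.
apply: DeriveDef.
  exact: (derivable_under_integral measurableT I0 intf derf G0 iG Gub).
rewrite -derive1E (differentiation_under_integral measurableT I0 intf derf G0 iG Gub).
by apply: eq_Rintegral => y _; rewrite d1f.
Qed.

Section kernel_derivative.
Context {R : realType} {n : nat}.
Local Notation mu := (leb R n).
Implicit Types (phi h : 'rV[R]_n -> R).

Definition dmoll_kernel phi (j : 'I_n) (e : R) (x y : 'rV[R]_n) : R :=
  e^-1 * e ^- n * partial j phi (e^-1 *: (x - y)).

Lemma dmoll_kernel_bounded phi j e : mollification_kernel phi ->
  exists M, forall x y, `|dmoll_kernel phi j e x y| <= M.
Proof.
move=> [sphi supphi _ _ _]; have [cdphi _] := sphi [:: j].
have phi_gt t := @kernel_support_gt _ _ phi t supphi.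
have [M phiM] := bounded_of_support cdphi (fun t => @partial_support_gt _ _ j phi t phi_gt).
by exists (`|e^-1 * e ^- n| * M) => x y; rewrite normrM ler_wpM2l// phiM.
Qed.

Lemma moll_kernel_bounded phi e : mollification_kernel phi ->
  exists M, forall x y, `|moll_kernel phi e x y| <= `|e ^- n| * M.
Proof.
move=> [sphi supphi _ _ _]; have [cphi _] := sphi [::].
have [M phiM] := bounded_of_support cphi (fun t => @kernel_support_gt _ _ phi t supphi).
by exists M => x y; rewrite normrM ler_wpM2l// phiM.
Qed.

Lemma dmoll_kernel_measurable phi j e x : mollification_kernel phi ->
  measurable_fun [set: lebType R n] (dmoll_kernel phi j e x).
Proof.
move=> [sphi _ _ _ _]; have [cdphi _] := sphi [:: j].
apply: leb_continuous_measurable => //.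
exact: (@continuous_dilate_refl _ _ (e^-1 * e ^- n) e^-1 x _ cdphi).
Qed.

Lemma is_derive_kconv_moll phi h (j : 'I_n) e x : mollification_kernel phi -> 0 < e ->
  L1 mu h ->
  is_derive x (delta_mx 0 j) (kconv mu (moll_kernel phi e) h)
    (kconv mu (dmoll_kernel phi j e) h x).
Proof.
move=> kphi e0 ih; have [sphi supphi phi0 _ _] := kphi.
have [cphi dphi] := sphi [::]; have [cdphi _] := sphi [:: j].
have ei0 : e^-1 != 0 by rewrite invr_eq0 gt_eqF.
set v := delta_mx 0 j.
have [M kM0] := moll_kernel_bounded e kphi.
have [M' k'M0] := dmoll_kernel_bounded j e kphi.
pose k (t : R) (y : lebType R n) : R := moll_kernel phi e (x + t *: v) y.
pose k' (t : R) (y : lebType R n) : R := dmoll_kernel phi j e (x + t *: v) y.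
have dk (t : R) y : is_derive t (1 : R) (k ^~ y) (k' t y).
  (* In its first variable the kernel is again a reflected dilation, centred at [y] and with the
     opposite factor. *)
  have mkE : (moll_kernel phi e)^~ y = dilate_refl (e ^- n) (- e^-1) y phi.
    apply/funext => z; rewrite /moll_kernel /dilate_refl; congr (_ * phi _).
    by rewrite scaleNr -scalerN opprB.
  have Nei0 : - e^-1 != 0 by rewrite oppr_eq0.
  have zE : - e^-1 *: (y - (x + t *: v)) = e^-1 *: (x + t *: v - y).
    by rewrite scaleNr -scalerN opprB.
  have [d1 d2] := is_derive_dilate_refl (e ^- n) Nei0 (dphi j (- e^-1 *: (y - (x + t *: v)))).
  have lE : k ^~ y = (fun s : R => dilate_refl (e ^- n) (- e^-1) y phi (x + s *: v)).
    by rewrite -mkE.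
  apply: DeriveDef; first by rewrite lE derivable_lineE.
  by rewrite lE derive_line d2 opprK zE.
have mk t : measurable_fun [set: lebType R n] (k t).
  exact/unit_kernel_measurable_r/moll_kernel_unit.
have kM t y : `|k t y| <= `|e ^- n| * M by exact: kM0.
have k'M' t y : `|k' t y| <= M' by exact: k'M0.
have [d1 d2] := @is_derive_Rintegral_mul R _ (lebType R n) mu h k k' _ _ ih mk kM dk k'M'.
pose F := kconv mu (moll_kernel phi e) h.
have xE : x + (0 : R) *: v = x by rewrite scale0r addr0.
have E1 := @derivable_lineE _ _ F x v 0; rewrite xE /F /kconv in E1.
have E2 := @derive_line _ _ F x v 0; rewrite xE /F /kconv in E2.
rewrite /k' xE in d2.
by apply: DeriveDef; rewrite /kconv; [rewrite -E1; exact: d1|rewrite -E2; exact: d2].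
Qed.

Lemma L1_patch (h : 'rV[R]_n -> R) (K : set (lebType R n)) : measurable K ->
  mu.-integrable K (EFin \o h) -> L1 mu (h \_ K).
Proof. by move=> mK /(integrable_mkcond _ mK); rewrite restrict_EFin. Qed.

Lemma integral_patch_mul (h k : 'rV[R]_n -> R) (K O : set 'rV[R]_n) : K `<=` O ->
  (forall y, ~ K y -> k y = 0) ->
  (\int[mu]_(y in O) (h y * k y)%:E = \int[mu]_y ((h \_ K) y * k y)%:E)%E.
Proof.
move=> KO k0; rewrite integral_mkcond; apply: eq_integral => y _.
rewrite !patchE; have [yO|yO] := boolP (y \in O).
  have [yK|yK] := boolP (y \in K); first by [].
  by rewrite k0 ?mulr0// -notin_setE.
rewrite [X in (_ * X)%:E]k0 ?mulr0// => Ky.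
by move: yO; rewrite notin_setE; apply; exact: KO.
Qed.

Section weak_gradient_mollified.
Context {N : nat} (Om : set 'rV[R]_n) (K : set 'rV[R]_n).
Variables (phi : 'rV[R]_n -> R) (u : 'rV[R]_n -> 'rV[R]_N) (Du : 'rV[R]_n -> 'M[R]_(N, n)).
Hypothesis kphi : mollification_kernel phi.
Hypothesis uDu : weak_gradient Om u Du.
Hypothesis (cK : compact K) (KOm : K `<=` Om).

Lemma L1_u_patch i : L1 mu ((fun x => u x 0 i) \_ K).
Proof.
have [L1u _ _] := uDu; apply: L1_patch; first exact: leb_compact_measurable.
exact: L1u.
Qed.

Lemma L1_Du_patch i j : L1 mu ((fun x => Du x i j) \_ K).
Proof.
have [_ L1Du _] := uDu; apply: L1_patch; first exact: leb_compact_measurable.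
exact: L1Du.
Qed.

(* The weak gradient tested against [y |-> phi_e (x - y)]. *)
Lemma partial_kconv_moll (e : R) x i j : 0 < e ->
  closure (eball x e) `<=` K ->
  partial j (kconv mu (moll_kernel phi e) ((fun x => u x 0 i) \_ K)) x =
  kconv mu (moll_kernel phi e) ((fun x => Du x i j) \_ K) x.
Proof.
move=> e0 xeK; have [sphi supphi phi0 _ _] := kphi.
have [cphi dphi] := sphi [::]; have [cdphi _] := sphi [:: j].
have ei0 : e^-1 != 0 by rewrite invr_eq0 gt_eqF.
rewrite /partial; have [_ ->] := is_derive_kconv_moll j x kphi e0 (L1_u_patch i).
pose psi := moll_kernel phi e x.
have psi_supp y : ~ K y -> psi y = 0.
  move=> Ky; apply: moll_kernel_eq0 => //; rewrite leNgt; apply/negP => xy.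
  by apply/Ky/xeK/subset_closure; rewrite /eball/= enormC.
(* Differentiating in [y] instead of [x] changes the sign, which cancels the sign in the definition
   of the weak gradient. *)
have dpsi y : partial j psi y = - dmoll_kernel phi j e x y.
  have [_] := is_derive_dilate_refl (e ^- n) ei0 (dphi j (e^-1 *: (x - y))).
  by rewrite -moll_kernelE /partial => ->; rewrite /dmoll_kernel !mulNr.
have supp_psi : supp psi `<=` closure (eball x e).
  apply: closureS => y; apply: contra_neqP; rewrite /eball/= => /negP.
  by rewrite -leNgt enormC => xy; exact: moll_kernel_eq0.
have tpsi : test_function Om psi.
  split; first by rewrite /psi moll_kernelE; exact: smooth_dilate_refl.
    have csupp : closed (supp psi) by exact: closed_closure.
    exact: subclosed_compact csupp (@closure_eball_compact R n x e) supp_psi.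
  by move=> y /supp_psi/xeK/KOm.
have [_ _ /(_ psi tpsi i j)] := uDu.
rewrite (integral_patch_mul _ KOm); last first.
  move=> y Ky; rewrite /partial (@near_eq_derive _ _ _ psi (cst 0)) ?derive_cst//.
  have -> : (\near y, psi y = cst 0 y) = nbhs y [set y | psi y = 0] by [].
  apply: (@filterS _ (nbhs y) _ (~` closure (eball x e))) => [z xz|].
    apply: moll_kernel_eq0 => //; rewrite leNgt; apply/negP => xze.
    by apply/xz/subset_closure; rewrite /eball/= enormC.
  apply: open_nbhs_nbhs; split; last by move=> /xeK.
  by rewrite openC; exact: closed_closure.
rewrite (integral_patch_mul _ KOm)// => uD.
have [M dkM] := dmoll_kernel_bounded j e kphi.
have mdk := dmoll_kernel_measurable j e x kphi.
have iUdk : L1 mu (fun y => ((fun x => u x 0 i) \_ K) y * dmoll_kernel phi j e x y).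
  exact: (L1_mul_bounded (L1_u_patch i) mdk (dkM x)).
have := RintegralZl (-1) measurableT iUdk.
rewrite mulN1r => E; apply: oppr_inj; rewrite -[LHS]E {E}.
rewrite /kconv /Rintegral -[X in _ = - X]/(fine _) -fineN -uD; congr fine.
by apply: eq_integral => y _; rewrite dpsi; congr EFin; ring.
Qed.

End weak_gradient_mollified.

End kernel_derivative.

(** * Integration by parts *)

Lemma normr_Rintegral_mul_le {R : realType} {d} {T : measurableType d}
    (mu : {sigma_finite_measure set T -> \bar R}) (h k : T -> R) M :
  L1 mu h -> measurable_fun setT k -> (forall y, `|k y| <= M) ->
  `|\int[mu]_y (h y * k y)| <= M * \int[mu]_y `|h y|.
Proof.
move=> ih mk kM; have ihk := L1_mul_bounded ih mk kM.
apply: (le_trans (le_normr_Rintegral measurableT ihk)).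
have inh := integrable_norm ih.
rewrite -RintegralZl//; apply: le_Rintegral => //.
- exact: integrable_norm.
- by have := integrableZl measurableT M inh.
- by move=> y _; rewrite normrM mulrC ler_wpM2r.
Qed.

Lemma integral_eq0_dominated {R : realType} {d} {T : measurableType d}
    (mu : {sigma_finite_measure set T -> \bar R}) (q : nat -> T -> R) (G D : T -> R) :
  (forall k, L1 mu (q k)) -> measurable_fun setT G -> L1 mu D ->
  (forall x, q k x @[k --> \oo] --> G x) -> (forall k x, `|q k x| <= D x) ->
  (forall k, (\int[mu]_x (q k x)%:E = 0)%E) ->
  (\int[mu]_x (G x)%:E = 0)%E.
Proof.
move=> iq mG iD qG qD q0.
have [] := @dominated_convergence _ T R mu setT measurableT
  (fun k x => (q k x)%:E) (fun x => (G x)%:E) (fun x => (D x)%:E).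
- by move=> k; exact: measurable_int (iq k).
- exact/measurable_EFinP.
- by apply: aeW => x _; apply: cvg_EFin; [exact: nearW|exact: qG].
- exact: iD.
- by apply: aeW => x k _; rewrite lee_fin.
move=> _ _ H; apply: (cvg_unique _ H) => //.
rewrite (_ : (fun n => _) = fun=> 0%E); first exact: cvg_cst.
by apply/funext => k; exact: q0.
Qed.

Lemma L1_bounded_on {R : realType} {d} {T : measurableType d}
    (mu : {sigma_finite_measure set T -> \bar R}) (g : T -> R) (A : set T) M :
  measurable A -> (mu A < +oo)%E -> measurable_fun setT g ->
  (forall x, `|g x| <= M) -> (forall x, ~ A x -> g x = 0) -> L1 mu g.
Proof.
move=> mA Aoo mg gM g0.
have iA : L1 mu (\1_A : T -> R) := L1_indic mA Aoo.
apply: (@eq_integrable _ _ _ _ setT measurableT (EFin \o (fun y => \1_A y * g y))).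
  move=> x _; congr EFin; rewrite indicE; have [/set_mem Ax|xA] := boolP (x \in A).
    by rewrite mul1r.
  by rewrite mul0r g0// -notin_setE.
exact: (L1_mul_bounded iA mg gM).
Qed.

Section integration_by_parts.
Context {R : realType} {n : nat}.
Local Notation mu := (leb R n).

(* By translation invariance the difference quotients of [g] have integral zero. *)
Lemma integral_partial_eq0 (g : 'rV[R]_n -> R) (j : 'I_n) M r :
  (forall x, derivable g x (delta_mx 0 j)) -> (forall x, `|partial j g x| <= M) ->
  (forall x, r <= `|x| -> g x = 0) -> L1 mu g ->
  measurable_fun [set: lebType R n] (partial j g) ->
  (\int[mu]_x (partial j g x)%:E = 0)%E.
Proof.
move=> dg gM g0 ig mG; pose v : 'rV[R]_n := delta_mx 0 j.
have M0 : 0 <= M by rewrite (le_trans _ (gM 0)).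
(* Steps of length at most 1 keep all difference quotients supported in [cube (r + 1)], so that [M]
   times its indicator is a common majorant. *)
pose t k : R := k.+1%:R^-1.
have t0 k : 0 < t k by rewrite invr_gt0.
have t1 k : t k <= 1 by rewrite invf_le1// ler1n.
pose q k x := (t k)^-1 * (g (x + t k *: v) - g x).
have igt k : L1 mu (fun x => g (x + t k *: v)).
  exact: (integrable_translate (t k *: v) ig).
have iq k : L1 mu (q k) := L1Z (t k)^-1 (L1B (igt k) ig).
have mC : measurable (cube (r + 1) : set (lebType R n)).
  exact/leb_open_measurable/cube_open.
have v1 : `|v| <= 1.
  rewrite [leLHS]mx_normrE; apply: bigmax_le => // -[a b] _ /=.
  by rewrite mxE; case: (_ && _); rewrite ?normr1 ?normr0.
have qM k x : `|q k x| <= M.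
  rewrite normrM gtr0_norm ?invr_gt0// ler_pdivrMl//.
  apply: (le_trans (directional_MVT x (t k) dg gM)).
  by rewrite gtr0_norm// mulrC.
have q0 k x : ~ cube (r + 1) x -> q k x = 0.
  move=> /negP; rewrite -leNgt => rx.
  rewrite /q g0 ?g0 ?subrr ?mulr0//; first lra.
  have tv : `|t k *: v| <= 1.
    by rewrite normrZ gtr0_norm// -[leRHS]mulr1 ler_pM// ltW.
  have := lerB_normD x (t k *: v); lra.
have iD : L1 mu (fun x => M * \1_(cube (r + 1)) x).
  apply: L1Z; apply: (@L1_bounded_on _ _ _ mu _ (cube (r + 1)) 1) => //.
  - exact: leb_cube_lty.
  - by move=> x; rewrite indicE; case: (_ \in _); rewrite ?normr1 ?normr0.
  - by move=> x xC; rewrite indicE memNset.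
refine (@integral_eq0_dominated _ _ _ mu q _ _ iq mG iD _ _ _).
- move=> x.
  have h : (t k) @[k --> \oo] --> (0 : R)^'.
    move=> A [e /= e0 eA].
    have /cvgr0Pnorm_lt/(_ _ e0) : t k @[k --> \oo] --> (0 : R) by exact: cvg_harmonic.
    apply: filterS => k te; apply: eA; last by rewrite gt_eqF.
    by rewrite /= sub0r normrN.
  have := cvg_comp _ _ h (dg x).
  rewrite -/v; apply: cvg_trans; apply: near_eq_cvg; near=> k.
  by rewrite /q /= (addrC x).
- move=> k x; rewrite indicE; have [xC|xC] := boolP (x \in cube (r + 1)).
    by rewrite mulr1.
  by rewrite q0 ?normr0 ?mulr0// -notin_setE.
- move=> k; have H : \int[mu]_x q k x = 0.
    rewrite /q RintegralZl//; last exact: (L1B (igt k) ig).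
    rewrite RintegralB//; last exact: igt.
    by rewrite /Rintegral (integral_translate (t k *: v) ig) subrr mulr0.
  have fq := integrable_fin_num measurableT (iq k).
  by rewrite -(fineK fq); congr EFin; exact: H.
Unshelve. all: by end_near. Qed.


Lemma bounded_of_compact_supp (psi : 'rV[R]_n -> R) : continuous psi ->
  compact (supp psi) -> exists M, forall x, `|psi x| <= M.
Proof.
move=> cpsi csupp.
have /compact_bounded[M [Mr gM]] : compact (psi @` supp psi).
  by apply: continuous_compact => //; exact: continuous_subspaceT.
exists (Num.max 0 (M + 1)) => x; rewrite le_max.
have [->|px] := eqVneq (psi x) 0; first by rewrite normr0 lexx.
apply/orP; right; apply: (gM (M + 1)); first by rewrite ltrDl.
by exists x => //; exact: subset_closure.
Qed.

Lemma partial_notin_supp (psi : 'rV[R]_n -> R) j x : ~ supp psi x -> partial j psi x = 0.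
Proof.
move=> px; rewrite /partial (@near_eq_derive _ _ _ psi (cst 0)) ?derive_cst//.
have -> : (\near x, psi x = cst 0 x) = nbhs x [set x | psi x = 0] by [].
apply: (@filterS _ (nbhs x) _ (~` supp psi)) => [z zx|].
  by apply: contra_notP zx => /eqP pz; exact: subset_closure.
by apply: open_nbhs_nbhs; split => //; rewrite openC; exact: closed_closure.
Qed.

(** The product of [g] and [psi] has compact support although [g] may not. The identity between the
    derivative of [g] and [G] is only used where [psi] lives, inside [O]. *)
Lemma integration_by_parts_test (psi g G : 'rV[R]_n -> R) (O : set 'rV[R]_n) (j : 'I_n) M :
  test_function O psi -> L1 mu g -> L1 mu G ->
  (forall x, derivable g x (delta_mx 0 j)) ->
  (forall x, O x -> partial j g x = G x) ->
  (forall x, `|g x| <= M) -> (forall x, `|partial j g x| <= M) ->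
  (\int[mu]_x (g x * partial j psi x)%:E = - \int[mu]_x (G x * psi x)%:E)%E.
Proof.
move=> [spsi cpsi suppO] ig iG dg gG gM dgM.
pose v : 'rV[R]_n := delta_mx 0 j.
have [c_psi dpsi] := spsi [::]; have [c_dpsi _] := spsi [:: j].
have psi0 x : ~ supp psi x -> psi x = 0.
  by apply: contra_notP => /eqP pz; exact: subset_closure.
have [M1 psiM] := bounded_of_compact_supp c_psi cpsi.
have cdpsi : compact (supp (partial j psi)).
  have cl : closed (supp (partial j psi)) by exact: closed_closure.
  apply: (subclosed_compact cl cpsi).
  have /closure_id -> : closed (supp psi) by exact: closed_closure.
  by apply: closureS => x; apply: contra_neqP; exact: partial_notin_supp.
have [M2 dpsiM] := bounded_of_compact_supp c_dpsi cdpsi.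
have mpsi : measurable_fun [set: lebType R n] psi by exact: leb_continuous_measurable.
have mdpsi : measurable_fun [set: lebType R n] (partial j psi).
  exact: leb_continuous_measurable.
have i1 := L1_mul_bounded ig mdpsi dpsiM.
have i2 := L1_mul_bounded iG mpsi psiM.
have igpsi := L1_mul_bounded ig mpsi psiM.
have dgpsi x : is_derive x v (fun x => g x * psi x) (g x * partial j psi x + psi x * partial j g x).
  have H := @is_deriveM _ _ g psi x v _ _ (derivableP (dg x)) (derivableP (dpsi j x)).
  by exact: H.
have pE : partial j (fun x => g x * psi x) = (fun x => g x * partial j psi x + G x * psi x).
  apply/funext => x; rewrite {1}/partial; have [_ ->] := dgpsi x.
  have [sx|sx] := pselect (supp psi x); first by rewrite gG ?(mulrC (psi x))//; exact: suppO.
  by rewrite psi0// mulr0 mul0r.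
have M0 : 0 <= M by rewrite (le_trans _ (gM 0)).
have M10 : 0 <= M1 by rewrite (le_trans _ (psiM 0)).
have [r hr] : exists r, forall x, r <= `|x| -> psi x = 0.
  have [r [rr hr]] := compact_bounded cpsi.
  exists (r + 2) => x rx; apply: psi0 => sx.
  have := hr (r + 1) _ x sx; rewrite ltrDl => /(_ ltr01) /=; lra.
have := @integral_partial_eq0 (fun x => g x * psi x) j (M * M2 + M * M1) r.
rewrite pE => H.
have : (\int[mu]_x (g x * partial j psi x + G x * psi x)%:E = 0)%E.
  refine (H _ _ _ _ _).
  - by move=> x; have [] := dgpsi x.
  - move=> x; have -> : g x * partial j psi x + G x * psi x =
      g x * partial j psi x + psi x * partial j g x.
      by have := congr1 (@^~ x) pE; rewrite {1}/partial; have [_ ->] := dgpsi x => ->.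
    apply: (le_trans (ler_normD _ _)); apply: lerD; rewrite normrM; first by rewrite ler_pM// ?gM ?dpsiM.
    by rewrite mulrC ler_pM// ?psiM ?dgM.
  - by move=> x rx; rewrite hr ?mulr0.
  - exact: igpsi.
  - exact: measurable_funD (L1_measurable i1) (L1_measurable i2).
rewrite (integralD_EFin measurableT i1 i2).
have := integrable_fin_num measurableT i1; have := integrable_fin_num measurableT i2.
rewrite /comp; case: (\int[mu]_x (g x * _)%:E)%E => // a; case: (\int[mu]_x (G x * _)%:E)%E => // b _ _.
by rewrite -EFinD => -[/eqP]; rewrite addr_eq0 => /eqP ->.
Qed.

End integration_by_parts.

(** * Jensen inequality and passage to the limit *)

Lemma cvg_powR0 {R : realType} {T : Type} (F : set_system T) {FF : Filter F} (f : T -> R) p :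
  0 < p -> (forall t, 0 <= f t) -> f @ F --> 0 -> f t `^ p @[t --> F] --> 0.
Proof.
move=> p0 f0 /cvgr0Pnorm_le fF; apply/cvgr0Pnorm_le => e e0.
have /fF : 0 < e `^ p^-1 by rewrite powR_gt0.
apply: filterS => t; rewrite ger0_norm// ger0_norm ?powR_ge0// => fe.
have ee : (e `^ p^-1) `^ p = e by rewrite -powRrM mulVf ?gt_eqF// powRr1// ltW.
by rewrite -[leRHS]ee ge0_ler_powR ?nnegrE ?powR_ge0// ltW.
Qed.

Section jensen.
Context {R : realType} {d} {T : measurableType d}.
Variable mu : {sigma_finite_measure set T -> \bar R}.

Lemma Rintegral_sum (I : Type) (r : seq I) (F : I -> T -> R) :
  (forall i, L1 mu (F i)) ->
  L1 mu (fun y => \sum_(i <- r) F i y) /\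
  \int[mu]_y (\sum_(i <- r) F i y) = \sum_(i <- r) \int[mu]_y F i y.
Proof.
move=> iF; elim: r => [|i r [iS IH]].
  split; last by under eq_Rintegral do rewrite big_nil; rewrite big_nil /Rintegral integral0.
  rewrite (_ : (fun _ => _) = fun=> 0); first exact: integrable0.
  by apply/funext => y; rewrite big_nil.
have E : (fun y => \sum_(j <- i :: r) F j y) = (fun y => F i y + \sum_(j <- r) F j y).
  by apply/funext => y; rewrite big_cons.
split; first by rewrite E; exact: L1D.
by rewrite E big_cons -IH; exact: (RintegralD measurableT (iF i) iS).
Qed.

Definition kconv_mx (k : T -> T -> R) {m p} (W : T -> 'M[R]_(m, p)) (x : T) : 'M[R]_(m, p) :=
  \matrix_(i, j) kconv mu k (fun y => W y i j) x.

(** The affine minorant of [g] at the mean [z0] has average exactly [g z0], because the kernel has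
    mass 1. Comparing with [H] wherever the kernel is nonzero dispenses with the integrability of
    [g (W y)]. *)
Lemma jensen_kconv (k : T -> T -> R) m p (W : T -> 'M[R]_(m, p)) (H : T -> R)
    (g : 'M[R]_(m, p) -> R) x :
  unit_kernel mu k -> convexE g -> (forall i j, L1 mu (fun y => W y i j)) -> L1 mu H ->
  (forall y, k x y != 0 -> g (W y) <= H y) ->
  g (kconv_mx k W x) <= kconv mu k H x.
Proof.
move=> uk cg iW iH gH; have [_ k0 bk _ k1] := uk.
set z0 := kconv_mx k W x.
have [L gL] := subgradient z0 cg.
pose c0 := g z0 - mxdot L z0.
have ik : L1 mu (k x).
  apply/integrableP; split; first exact/measurable_EFinP/(unit_kernel_measurable_r x uk).
  rewrite (eq_integral (fun y => (k x y)%:E)) ?k1 ?ltry// => y _.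
  by rewrite gee0_abs// lee_fin.
have k1R : \int[mu]_y k x y = 1 by rewrite /Rintegral k1.
pose F (ij : 'I_m * 'I_p) y := L ij.1 ij.2 * (W y ij.1 ij.2 * k x y).
have iF ij : L1 mu (F ij) by apply: L1Z; exact: kconv_integrable.
have [iS sumE] := Rintegral_sum (enum {: 'I_m * 'I_p}) iF.
have ic0 : L1 mu (fun y => c0 * k x y) by exact: L1Z.
have iHk : L1 mu (fun y => H y * k x y) by exact: kconv_integrable.
have mxdotE M z : mxdot M z = \sum_(ij <- enum {: 'I_m * 'I_p}) M ij.1 ij.2 * z ij.1 ij.2.
  by rewrite /mxdot pair_bigA/= big_enum.
have -> : g z0 = \int[mu]_y (c0 * k x y + \sum_(ij <- enum {: 'I_m * 'I_p}) F ij y).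
  rewrite RintegralD// sumE RintegralZl// k1R mulr1 /c0 mxdotE.
  rewrite -[LHS]addr0 -addrA; congr (_ + _); apply/eqP; rewrite eq_sym addrC subr_eq0; apply/eqP.
  apply: eq_bigr => ij _; rewrite RintegralZl//; last exact: kconv_integrable.
  by rewrite mxE.
apply: le_Rintegral => //; first exact: L1D.
move=> y _; have -> : \sum_(ij <- enum {: 'I_m * 'I_p}) F ij y = mxdot L (W y) * k x y.
  by rewrite mxdotE mulr_suml; apply: eq_bigr => ij _; rewrite /F mulrA.
rewrite -mulrDl; have [->|kxy] := eqVneq (k x y) 0; first by rewrite !mulr0.
rewrite ler_wpM2r//; apply: le_trans (gH _ kxy).
have := gL (W y); rewrite mxdotD -[- z0]scaleN1r mxdotZ /c0; lra.
Qed.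

End jensen.

Section fast_convergence.
Context {R : realType} {d} {T : measurableType d}.
Variable mu : {sigma_finite_measure set T -> \bar R}.

Let pow_half : (\sum_(k <oo) ((2 ^ k.+1)%:R^-1 : R)%:E <= 1)%E.
Proof.
have := @epsilon_trick0 R 1 xpredT ler01; apply: le_trans.
by apply: lee_nneseries => [k' *|k' *]; rewrite ?lee_fin ?invr_ge0// div1r.
Qed.

(* Summability of the distances gives a.e. convergence and a common majorant. *)
Lemma fast_dist1_cvg (f : nat -> T -> R) (g : T -> R) :
  (forall k, L1 mu (f k)) -> L1 mu g ->
  (forall k, (dist1 mu (f k) g <= ((2 ^ k.+1)%:R^-1)%:E)%E) ->
  {ae mu, forall x, f k x @[k --> \oo] --> g x} /\
  exists S : T -> \bar R, [/\ mu.-integrable setT S, forall x, (0 <= S x)%E &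
    forall k x, (`|f k x|%:E <= `|g x|%:E + S x)%E].
Proof.
move=> fi gi fg.
pose S x := (\sum_(k <oo) `|f k x - g x|%:E)%E.
have mfg k : measurable_fun setT (fun x => `|f k x - g x|%:E).
  apply/measurable_EFinP/measurableT_comp => //.
  exact: measurable_funB (L1_measurable (fi k)) (L1_measurable gi).
have S0 x : (0 <= S x)%E by apply: nneseries_ge0 => *; rewrite lee_fin.
have iS : mu.-integrable setT S.
  apply/integrableP; split.
    by apply: ge0_emeasurable_sum => // k x _ _; rewrite lee_fin.
  rewrite (eq_integral S); last by move=> x _; rewrite gee0_abs.
  rewrite integral_nneseries//.
  apply: (@le_lt_trans _ _ 1%E); last exact: ltry.
  apply: (le_trans _ pow_half); apply: lee_nneseries => [k *|k *]; last exact: fg.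
  exact: integral_ge0.
split; last first.
  exists S; split => // k x.
  apply: (@le_trans _ _ (`|g x|%:E + `|f k x - g x|%:E)%E).
    by rewrite -EFinD lee_fin -{1}(subrK (g x) (f k x)) addrC ler_normD.
  apply: leeD2l; rewrite /S.
  apply: (@le_trans _ _ (\sum_(0 <= i < k.+1) `|f i x - g x|%:E)%E).
    by rewrite big_nat_recr//= leeDr// sume_ge0// => *; rewrite lee_fin.
  by apply: nneseries_lim_ge => *; rewrite lee_fin.
have := integrable_ae measurableT iS; apply: filterS => x /(_ Logic.I) Sx.
suff /cvg_series_cvg_0 h0 : cvgn (series (fun k => `|f k x - g x|)).
  apply/cvgrPdist_le => e e0; move/cvgr0Pnorm_le : h0 => /(_ _ e0).
  by apply: filterS => k; rewrite normr_id distrC.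
apply: nondecreasing_is_cvgn.
  by apply/nondecreasing_seqP => k; rewrite /series/= big_nat_recr//= lerDl.
exists (fine (S x)) => _ [k _ <-]; rewrite -lee_fin fineK// /series/= -sumEFin.
by apply: nneseries_lim_ge => *; rewrite lee_fin.
Qed.

Variable K : R -> T -> T -> R.
Hypothesis K_unit : forall e, 0 < e -> unit_kernel mu (K e).
Hypothesis K_cvg : forall h, L1 mu h -> dist1 mu (kconv mu (K e) h) h @[e --> 0^'+] --> 0%E.

(** The common engine for the energies and the [p]-th powers. Finitely many functions [w j] are
    averaged along one fast sequence; they drive the pointwise convergence of [H], while the
    distinguished [w j0] dominates it. *)
Lemma cvg_integral_kconv (J : finType) (w : J -> T -> R) (j0 : J) (D : set T)
    (H : R -> T -> R) (H0 L : T -> R) (C : R) :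
  (forall j, L1 mu (w j)) -> mu.-integrable D (EFin \o L) -> measurable D ->
  (\forall e \near 0^'+, measurable_fun D (H e)) -> measurable_fun D H0 -> 0 <= C ->
  (\forall e \near 0^'+, forall x, D x ->
     `|H e x| <= C * `|kconv mu (K e) (w j0) x| + L x) ->
  (forall (s : nat -> R) x, (forall k, 0 < s k) -> s k @[k --> \oo] --> 0 -> D x ->
    (forall j, kconv mu (K (s k)) (w j) x @[k --> \oo] --> w j x) ->
    H (s k) x @[k --> \oo] --> H0 x) ->
  (\int[mu]_(x in D) (H e x)%:E)%E @[e --> 0^'+] --> (\int[mu]_(x in D) (H0 x)%:E)%E.
Proof.
move=> iw iL mD mH mH0 C0 HC Hcvg.
have Kfast k j : \forall e \near 0^'+,
    (dist1 mu (kconv mu (K e) (w j)) (w j) <= ((2 ^ k.+1)%:R^-1)%:E)%E.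
  have /fine_cvgP[h1 /cvgr0Pnorm_le h2] := K_cvg (iw j).
  have pk : 0 < (2 ^ k.+1)%:R^-1 :> R by rewrite invr_gt0 ltr0n expn_gt0.
  near=> e; rewrite -(@fineK _ (dist1 _ _ _)); last by near: e; exact: h1.
  by rewrite lee_fin (le_trans (ler_norm _))//; near: e; exact: h2.
pose P k e := [/\ measurable_fun D (H e),
  forall x, D x -> `|H e x| <= C * `|kconv mu (K e) (w j0) x| + L x &
  forall j, (dist1 mu (kconv mu (K e) (w j)) (w j) <= ((2 ^ k.+1)%:R^-1)%:E)%E].
apply: (@cvg_at_right0_seq _ _ _ _ P) => [k|s s0 s_cvg sP].
  near=> e; split; near: e => //.
  by apply: filter_forall => j; exact: Kfast.
have ikw k j : L1 mu (kconv mu (K (s k)) (w j)) by have [] := kconv_L1 (K_unit (s0 k)) (iw j).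
have fast j := fast_dist1_cvg (fun k => ikw k j) (iw j) (fun k => let: And3 _ _ h := sP k in h j).
have [_ [S [iS S0 wS]]] := fast j0.
have aew : {ae mu, forall x, forall j, kconv mu (K (s k)) (w j) x @[k --> \oo] --> w j x}.
  by apply: filter_forall => j; have [] := fast j.
(* The averages of [w j0] along the fast sequence are all bounded by [|w j0| + S], with [S] the sum
   of the pointwise distances. *)
pose B x : \bar R := (C%:E * (`|w j0 x|%:E + S x) + (L x)%:E)%E.
have iB : mu.-integrable D B.
  apply: integrableD => //; apply: integrableZl => //; apply: (integrableS measurableT) => //.
  by apply: integrableD => //; have := integrable_norm (iw j0); exact.
have [] := @dominated_convergence _ T R mu D mD
  (fun k x => (H (s k) x)%:E) (fun x => (H0 x)%:E) B.
- by move=> k; apply/measurable_EFinP; have [] := sP k.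
- exact/measurable_EFinP.
- apply: filterS aew => x wx Dx; apply: cvg_EFin; first exact: nearW.
  exact: Hcvg.
- exact: iB.
- apply: aeW => x k Dx; have [_ /(_ x Dx) h _] := sP k.
  apply: (@le_trans _ _ (C%:E * `|kconv mu (K (s k)) (w j0) x|%:E + (L x)%:E)%E).
    by rewrite -EFinM -EFinD lee_fin.
  by apply: leeD2r; apply: lee_wpmul2l; rewrite ?lee_fin.
- by [].
Unshelve. all: by end_near. Qed.

Lemma kconv_mx_measurable (D : set T) m l (W : T -> 'M[R]_(m, l)) e : 0 < e ->
  (forall i j, L1 mu (fun y => W y i j)) -> measurable D ->
  forall i j, measurable_fun D (fun x => kconv_mx mu (K e) W x i j).
Proof.
move=> e0 iW mD i j; have [iKW _] := kconv_L1 (K_unit e0) (iW i j).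
rewrite (_ : (fun x => _) = kconv mu (K e) (fun y => W y i j)).
  exact: measurable_funTS (L1_measurable iKW).
by apply/funext => x; rewrite mxE.
Qed.

(** [G] is an integrable majorant of the [p]-th power that survives averaging. It joins the entries
    of [W] as the index [None], so that all are handled along the same sequence. *)
Lemma cvg_integral_enorm_powR m l (W : T -> 'M[R]_(m, l)) (G : T -> R) (D : set T) (C p : R) :
  0 < p -> 0 <= C -> (forall i j, L1 mu (fun y => W y i j)) -> L1 mu G -> measurable D ->
  (forall x, D x -> enorm (W x) `^ p <= C * G x) ->
  (\forall e \near 0^'+, forall x, D x ->
     enorm (kconv_mx mu (K e) W x) `^ p <= C * kconv mu (K e) G x) ->
  (\int[mu]_(x in D) (enorm (kconv_mx mu (K e) W x - W x) `^ p)%:E)%E @[e --> 0^'+] --> 0%E.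
Proof.
move=> p0 C0 iW iG mD WG KWG.
have mW i j : measurable_fun D (fun x => W x i j).
  exact: measurable_funTS (L1_measurable (iW i j)).
pose w (o : option ('I_m * 'I_l)) := if o is Some ij then (fun y => W y ij.1 ij.2) else G.
have iw o : L1 mu (w o) by case: o => [ij|] //=; exact: iW.
rewrite (_ : 0%E = (\int[mu]_(x in D) ((0 : R))%:E)%E); last by rewrite integral0.
apply: (@cvg_integral_kconv _ w None D _ (fun=> 0) (fun x => 2 `^ p * (C * `|G x|)) (2 `^ p * C)) => //.
- apply: (integrableS measurableT) => //.
  have := integrable_norm iG => iG'.
  exact: (integrableZl measurableT (2 `^ p) (integrableZl measurableT C iG')).
- near=> e; have e0 : 0 < e by [].
  apply: (measurableT_comp (measurable_powR p)).
  apply: (@measurable_continuous_comp _ _ _ _ _ D (fun x => kconv_mx mu (K e) W x - W x)) => //.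
    move=> i j; rewrite (_ : (fun x => _) = (fun x => kconv_mx mu (K e) W x i j - W x i j)).
      by apply: measurable_funB => //; exact: kconv_mx_measurable.
    by apply/funext => x; rewrite !mxE.
  exact: enorm_continuous.
- by rewrite mulr_ge0 ?powR_ge0.
- near=> e => x Dx; rewrite ger0_norm ?powR_ge0//.
  apply: (le_trans (enorm_sub_powR _ _ (ltW p0))).
  rewrite -mulrA -mulrDr ler_wpM2l ?powR_ge0// lerD//.
    have h : enorm (kconv_mx mu (K e) W x) `^ p <= C * kconv mu (K e) G x.
      by move: x Dx; near: e; exact: KWG.
    by apply: (le_trans h); rewrite ler_wpM2l// ler_norm.
  by apply: (le_trans (WG x Dx)); rewrite ler_wpM2l// ler_norm.
- move=> s x s0 s_cvg Dx wx.
  apply: cvg_powR0 => //; first by move=> k; exact: enorm_ge0.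
  have h : kconv_mx mu (K (s k)) W x - W x @[k --> \oo] --> (0 : 'M[R]_(m, l)).
    apply: mx_cvgP => i j; rewrite mxE.
    under eq_cvg do rewrite !mxE.
    by apply/subr_cvg0; exact: (wx (Some (i, j))).
  rewrite -(@enorm0 R m l); exact: (cvg_comp _ _ h (@enorm_continuous _ _ _ 0)).
Unshelve. all: by end_near. Qed.

End fast_convergence.

(** * Mollified Sobolev functions *)

Lemma eballs_in_compact {R : realType} {n : nat} (Om B : set 'rV[R]_n) :
  open Om -> bounded_set Om -> compact B -> B `<=` Om ->
  exists (K : set 'rV[R]_n) (d : R), [/\ compact K, K `<=` Om, 0 < d &
    forall x e, B x -> e <= d -> closure (eball x e) `<=` K].
Proof.
move=> oOm bOm cB BOm.
have [d [d0 hd]] : exists d : R, 0 < d /\ forall x, B x -> ball x d `<=` Om.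
  near (0 : R)^'+ => d; exists d; split => //.
  by near: d; exact: compact_sub_open_near.
(* The points at distance at least [d / 2] from the complement: an intersection of closed sets,
   bounded because [Om] is, and half of the margin [d] is left for the balls. *)
pose K := [set y : 'rV[R]_n | forall z, ~ Om z -> d / 2 <= `|y - z|].
have KOm : K `<=` Om.
  move=> y Ky; apply: contrapT => /Ky; rewrite subrr normr0; lra.
exists K, (d / 2); split => //; last first.
- move=> x e Bx ed y /closure_eball_le/= yx z Omz.
  have xz : d <= `|x - z|.
    rewrite leNgt; apply/negP => xz; apply/Omz/(hd x Bx).
    by rewrite mx_norm_ball.
  have yx' : `|y - x| <= d / 2 by rewrite (le_trans (norm_le_enorm _))// (le_trans yx).
  have := ler_distD y x z; rewrite (distrC x y); lra.
- by rewrite divr_gt0.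
apply: bounded_closed_compact; first by
  case: bOm => [M [Mr hM]]; exists M; split=> // r rM y /KOm; exact: hM.
have -> : K = \bigcap_(z in ~` Om) [set y | d / 2 <= `|y - z|] by [].
apply: closed_bigI => z _.
have -> : [set y : 'rV[R]_n | d / 2 <= `|y - z|] = (fun y => `|y - z|) @^-1` [set t | d / 2 <= t] by [].
apply: closed_comp => [y _|]; last exact: closed_ge.
have h : (t - z) @[t --> y] --> y - z.
  by apply: (@cvgB _ _ _ (nbhs y) (nbhs_filter y)); [exact: cvg_id|exact: cvg_cst].
exact: (continuous_comp h (@norm_continuous _ _ _)).
Unshelve. all: by end_near. Qed.

Section mollified.
Context {R : realType} {n N : nat}.
Local Notation mu := (leb R n).
Variables (Om K B : set 'rV[R]_n) (d : R) (phi : 'rV[R]_n -> R).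
Variables (u : 'rV[R]_n -> 'rV[R]_N) (Du : 'rV[R]_n -> 'M[R]_(N, n)).
Hypothesis (kphi : mollification_kernel phi).
Hypothesis (uDu : weak_gradient Om u Du).
Hypothesis (cK : compact K) (KOm : K `<=` Om).
Hypothesis (BK : forall x e, B x -> e <= d -> closure (eball x e) `<=` K).

(** Extension by zero off [K], entry by entry: it makes a locally integrable map integrable on the
    whole space. *)
Definition mx_patch {m l} (W : 'rV[R]_n -> 'M[R]_(m, l)) (x : 'rV[R]_n) : 'M[R]_(m, l) :=
  \matrix_(i, j) ((fun y => W y i j) \_ K) x.

Lemma mx_patchE m l (W : 'rV[R]_n -> 'M[R]_(m, l)) x : K x -> mx_patch W x = W x.
Proof. by move=> Kx; apply/matrixP => i j; rewrite mxE patchE mem_set. Qed.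

Lemma mx_patch_entry m l (W : 'rV[R]_n -> 'M[R]_(m, l)) i j :
  (fun y => mx_patch W y i j) = (fun y => W y i j) \_ K.
Proof. by apply/funext => y; rewrite mxE. Qed.

Lemma mollify_kconv x e : B x -> 0 < e -> e <= d ->
  mollify phi u e x = kconv_mx mu (moll_kernel phi e) (mx_patch u) x.
Proof.
move=> Bx e0 ed; apply/matrixP => a i; rewrite ord1 !mxE.
rewrite mx_patch_entry /kconv /Rintegral; congr fine.
rewrite integral_mkcond; apply: eq_integral => y _; rewrite !patchE.
have [/set_mem yx|yx] := boolP (y \in eball x e).
  by rewrite mem_set//; apply: (BK Bx ed); exact: subset_closure.
rewrite moll_kernel_eq0 ?mulr0//; move: yx; rewrite notin_setE /eball/= => /negP.
by rewrite -leNgt enormC.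
Qed.

(** Derivatives are local: the mollification agrees with the convolution of the cut-off on the open
    set [B], hence so do the gradients. *)
Lemma grad_mollify x e : open B -> B x -> 0 < e -> e <= d ->
  grad (mollify phi u e) x = kconv_mx mu (moll_kernel phi e) (mx_patch Du) x.
Proof.
move=> oB Bx e0 ed; apply/matrixP => i j; rewrite !mxE mx_patch_entry.
rewrite -(partial_kconv_moll kphi uDu cK KOm i j e0 (BK Bx ed)).
rewrite /partial; apply: near_eq_derive.
have : nbhs x B by exact: open_nbhs_nbhs.
by apply: filterS => y By; rewrite mollify_kconv// mxE mx_patch_entry.
Qed.

Lemma L1_mx_patch_u i j : L1 mu (fun y => mx_patch u y i j).
Proof. by rewrite mx_patch_entry ord1; exact: (L1_u_patch uDu cK KOm j). Qed.

Lemma L1_mx_patch_Du i j : L1 mu (fun y => mx_patch Du y i j).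
Proof. by rewrite mx_patch_entry; exact: (L1_Du_patch uDu cK KOm i j). Qed.

End mollified.

(** * Lebesgue norms on a set through powers of the Euclidean norm *)

Section Lnorm_on_facts.
Context {R : realType} {n m l : nat}.
Implicit Types (D : set (lebType R n)) (g : 'rV[R]_n -> 'M[R]_(m, l)) (p : R).

Lemma Lnorm_onE p D g : p != 0 ->
  Lnorm_on p D g = ((\int[leb R n]_(x in D) (enorm (g x) `^ p)%:E) `^ p^-1)%E.
Proof.
move=> p0; rewrite /Lnorm_on unlock; congr (_ `^ _)%E.
rewrite [RHS]integral_mkcond; apply: eq_integral => x _; rewrite !patchE.
case: ifP => _; last by rewrite abse0 poweR0r.
by rewrite gee0_abs ?lee_fin ?enorm_ge0// poweR_EFin.
Qed.

Lemma eq_Lnorm_on p D g g' : {in D, g =1 g'} -> Lnorm_on p D g = Lnorm_on p D g'.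
Proof.
move=> gg'; rewrite /Lnorm_on; congr (Lnorm _ _ _); apply/funext => x; rewrite !patchE.
by case: ifP => // xD; rewrite gg'.
Qed.

Lemma enorm_powR_measurable p D g : measurable D ->
  (forall i j, measurable_fun D (fun x => g x i j)) ->
  measurable_fun D (fun x => enorm (g x) `^ p).
Proof.
move=> mD mg; apply: (measurableT_comp (measurable_powR p)).
by apply: (@measurable_continuous_comp _ _ _ _ _ D g) => //; exact: enorm_continuous.
Qed.

Lemma Lp_bounded p D g M : 0 < p -> measurable D -> (leb R n D < +oo)%E ->
  (forall i j, measurable_fun D (fun x => g x i j)) ->
  (forall x, D x -> enorm (g x) <= M) -> Lp p D g.
Proof.
move=> p0 mD Doo mg gM; split => //; rewrite Lnorm_onE ?gt_eqF//; apply: poweR_lty.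
apply: (@le_lt_trans _ _ (\int[leb R n]_(x in D) (cst (M `^ p)%:E) x)%E).
  refine (ge0_le_integral _ mD _ _ _ _).
  - by move=> x _; rewrite lee_fin powR_ge0.
  - by apply/measurable_EFinP; exact: enorm_powR_measurable.
  - exact: measurable_cst.
  - move=> x Dx; rewrite lee_fin ge0_ler_powR ?nnegrE ?enorm_ge0 ?(ltW p0)//; last exact: gM.
    exact: le_trans (enorm_ge0 _) (gM x Dx).
rewrite integral_cst//; apply: lte_mul_pinfty => //.
by rewrite lee_fin powR_ge0.
Qed.

Lemma LpS p D D' g : 0 < p -> measurable D -> measurable D' -> D `<=` D' ->
  Lp p D' g -> Lp p D g.
Proof.
move=> p0 mD mD' DD' [mg Lg].
have mgD i j : measurable_fun D (fun x => g x i j) by exact: measurable_funS (mg i j).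
split=> //; move: Lg; rewrite !Lnorm_onE ?gt_eqF// => Lg.
apply: poweR_lty; apply: (@le_lt_trans _ _ (\int[leb R n]_(x in D') (enorm (g x) `^ p)%:E)%E).
  refine (ge0_subset_integral _ mD mD' _ _ DD').
  - by apply/measurable_EFinP; exact: enorm_powR_measurable.
  - by move=> x _; rewrite lee_fin powR_ge0.
by apply: lty_poweRy Lg; rewrite invr_eq0 gt_eqF.
Qed.

Lemma Lp_integrable p D g : 0 < p -> measurable D -> Lp p D g ->
  (leb R n).-integrable D (EFin \o (fun x => enorm (g x) `^ p)).
Proof.
move=> p0 mD [mg]; rewrite Lnorm_onE ?gt_eqF// => Lg; apply/integrableP; split.
  by apply/measurable_EFinP; exact: enorm_powR_measurable.
have -> : (\int[leb R n]_(x in D) `|((enorm (g x) `^ p)%R)%:E| =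
    \int[leb R n]_(x in D) (enorm (g x) `^ p)%:E)%E.
  by apply: eq_integral => x _; rewrite /= ger0_norm// powR_ge0.
by apply: lty_poweRy Lg; rewrite invr_eq0 gt_eqF.
Qed.

Lemma cvg_Lnorm_on p D (v : R -> 'rV[R]_n -> 'M[R]_(m, l)) : 0 < p ->
  (\int[leb R n]_(x in D) (enorm (v e x) `^ p)%:E)%E @[e --> 0^'+] --> 0%E ->
  Lnorm_on p D (v e) @[e --> 0^'+] --> 0%E.
Proof.
move=> p0 /fine_cvgP[vfin vcvg]; apply/fine_cvgP; split.
  by apply: filterS vfin => e ve; rewrite Lnorm_onE ?gt_eqF// fin_num_poweR.
under eq_cvg do rewrite /= Lnorm_onE ?gt_eqF// fine_poweR.
apply: cvg_powR0 => //; first by rewrite invr_gt0.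
by move=> e; rewrite fine_ge0// integral_ge0// => x _; rewrite lee_fin powR_ge0.
Qed.

End Lnorm_on_facts.

(** Each [a i] is at most the [1/p]-th power of the sum of the [p]-th powers, and there are [#|I|]
    of them. *)
Lemma sum_powR_le {R : realType} (I : finType) (a : I -> R) p : 0 < p -> (forall i, 0 <= a i) ->
  (\sum_i a i) `^ p <= #|I|%:R `^ p * \sum_i a i `^ p.
Proof.
move=> p0 a0; set S := \sum_i a i `^ p.
have S0 : 0 <= S by rewrite sumr_ge0// => i _; rewrite powR_ge0.
have SS : (S `^ p^-1) `^ p = S by rewrite -powRrM mulVf ?gt_eqF// powRr1.
rewrite -[X in _ * X]SS -powRM ?powR_ge0//.
rewrite ge0_ler_powR ?nnegrE ?(ltW p0) ?mulr_ge0 ?powR_ge0 ?sumr_ge0//.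
rewrite mulr_natl -sumr_const; apply: ler_sum => i _.
have -> : a i = (a i `^ p) `^ p^-1 by rewrite -powRrM mulfV ?gt_eqF// powRr1.
rewrite ge0_ler_powR ?nnegrE ?invr_ge0 ?(ltW p0) ?powR_ge0//.
by rewrite /S (bigD1 i)//= lerDl sumr_ge0// => j _; rewrite powR_ge0.
Qed.

(** A convex function comparable to the [p]-th power of the norm, whose convexity reduces to one
    real variable. *)
Definition sum_powR {R : realType} {m l : nat} (p : R) (z : 'M[R]_(m, l)) : R :=
  \sum_(ij : 'I_m * 'I_l) `|z ij.1 ij.2| `^ p.

Lemma sum_powR_convex {R : realType} m l (p : R) : 1 <= p -> convexE (@sum_powR R m l p).
Proof.
move=> p1 t x y t01; have [t0 t1] := andP t01.
rewrite /sum_powR !mulr_sumr -big_split/=; apply: ler_sum => ij _; rewrite !mxE.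
set a := x _ _; set b := y _ _.
have t1' : 0 <= 1 - t by rewrite subr_ge0.
apply: (@le_trans _ _ ((t * `|a| + (1 - t) * `|b|) `^ p)).
  rewrite ge0_ler_powR ?nnegrE ?addr_ge0 ?mulr_ge0//; first exact: le_trans ler01 p1.
  by rewrite (le_trans (ler_normD _ _))// !normrM (ger0_norm t0) (ger0_norm t1').
have := convex_powR p1 (Itv01 t0 t1) (x := `|a|) (y := `|b|).
rewrite !inE /= !in_itv/= !andbT !normr_ge0 => /(_ isT isT).
by rewrite !convRE.
Qed.

Lemma enorm_powR_le_sum {R : realType} m l (p : R) (z : 'M[R]_(m, l)) : 0 < p ->
  enorm z `^ p <= #|{: 'I_m * 'I_l}|%:R `^ p * sum_powR p z.
Proof.
move=> p0; apply: le_trans (sum_powR_le p0 _); last by [].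
rewrite ge0_ler_powR ?nnegrE ?(ltW p0) ?enorm_ge0 ?sumr_ge0//.
by rewrite (le_trans (enorm_le_sum z))// pair_bigA.
Qed.

Section mollified_sobolev.
Context {R : realType} {n N : nat}.
Local Notation mu := (leb R n).
Variables (Om K B : set 'rV[R]_n) (d : R) (phi : 'rV[R]_n -> R).
Variables (u : 'rV[R]_n -> 'rV[R]_N) (Du : 'rV[R]_n -> 'M[R]_(N, n)).
Hypothesis (kphi : mollification_kernel phi).
Hypothesis (uDu : weak_gradient Om u Du).
Hypothesis (cK : compact K) (KOm : K `<=` Om).
Hypothesis (BK : forall x e, B x -> e <= d -> closure (eball x e) `<=` K).
Hypothesis (oB : open B).

Let mB : measurable (B : set (lebType R n)). Proof. exact: leb_open_measurable. Qed.

Let kconv_derivable (e : R) h j x : 0 < e -> L1 mu h ->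
  derivable (kconv mu (moll_kernel phi e) h) x (delta_mx 0 j).
Proof. by move=> e0 ih; have [] := is_derive_kconv_moll j x kphi e0 ih. Qed.

Let kconv_bounded (e : R) h : 0 < e -> L1 mu h ->
  exists M, forall x, `|kconv mu (moll_kernel phi e) h x| <= M.
Proof.
move=> e0 ih; have [M kM] := moll_kernel_bounded e kphi.
exists (`|e ^- n| * M * \int[mu]_y `|h y|) => x.
exact: (normr_Rintegral_mul_le ih
  (unit_kernel_measurable_r x (moll_kernel_unit kphi e0)) (kM x)).
Qed.

Let dkconv_bounded (e : R) h j : 0 < e -> L1 mu h ->
  exists M, forall x, `|partial j (kconv mu (moll_kernel phi e) h) x| <= M.
Proof.
move=> e0 ih; have [M kM] := dmoll_kernel_bounded j e kphi.
exists (M * \int[mu]_y `|h y|) => x.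
rewrite /partial; have [_ ->] := is_derive_kconv_moll j x kphi e0 ih.
exact: (normr_Rintegral_mul_le ih (dmoll_kernel_measurable j e x kphi) (kM x)).
Qed.

Let integrable_on h g (A : set (lebType R n)) : L1 mu h -> measurable A ->
  (forall x, A x -> g x = h x) -> mu.-integrable A (EFin \o g).
Proof.
move=> ih mA gh; have := integrableS measurableT mA (@subsetT _ A) ih.
by apply: eq_integrable => // x /set_mem Ax; rewrite /= gh.
Qed.

(** The convolution of the cut-off [u] is differentiable everywhere, but its gradient is the
    convolution of [Du] only on [B]; the test functions are supported there, so
    [integration_by_parts_test] applies. *)
Lemma weak_gradient_mollify (e : R) : 0 < e -> e <= d ->
  weak_gradient B (mollify phi u e) (grad (mollify phi u e)).
Proof.
move=> e0 ed; have up := moll_kernel_unit kphi e0.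
have iU i := L1_mx_patch_u uDu cK KOm 0 i.
have iDU i j := L1_mx_patch_Du uDu cK KOm i j.
have uE x i : B x -> mollify phi u e x 0 i =
    kconv mu (moll_kernel phi e) (fun y => mx_patch K u y 0 i) x.
  by move=> Bx; rewrite (mollify_kconv u kphi BK Bx e0 ed) mxE.
have DuE x i j : B x -> grad (mollify phi u e) x i j =
    kconv mu (moll_kernel phi e) (fun y => mx_patch K Du y i j) x.
  by move=> Bx; rewrite (grad_mollify kphi uDu cK KOm BK oB Bx e0 ed) mxE.
have [ikU ikDU] := (fun i => (kconv_L1 up (iU i)).1, fun i j => (kconv_L1 up (iDU i j)).1).
split.
- move=> i A cA AB; apply: (integrable_on (ikU i)); first exact: leb_compact_measurable.
  by move=> x /AB; exact: uE.
- move=> i j A cA AB; apply: (integrable_on (ikDU i j)); first exact: leb_compact_measurable.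
  by move=> x /AB; exact: DuE.
move=> psi tpsi i j; have [_ _ suppB] := tpsi.
have psi0 x : ~ supp psi x -> psi x = 0.
  by apply: contra_notP => /eqP px; exact: subset_closure.
have [M1 kM1] := kconv_bounded e0 (iU i).
have [M2 kM2] := dkconv_bounded j e0 (iU i).
have := @integration_by_parts_test R n psi _ _ B j (Num.max M1 M2) tpsi (ikU i) (ikDU i j).
have dE x : B x -> partial j (kconv mu (moll_kernel phi e) (fun y => mx_patch K u y 0 i)) x =
    kconv mu (moll_kernel phi e) (fun y => mx_patch K Du y i j) x.
  move=> Bx; rewrite !mx_patch_entry.
  exact: (partial_kconv_moll kphi uDu cK KOm i j e0 (BK Bx ed)).
have H1 x : derivable (kconv mu (moll_kernel phi e) (fun y => mx_patch K u y 0 i)) x (delta_mx 0 j).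
  exact: kconv_derivable.
have H2 x : `|kconv mu (moll_kernel phi e) (fun y => mx_patch K u y 0 i) x| <= Num.max M1 M2.
  by rewrite (le_trans (kM1 x))// le_max lexx.
have H3 x : `|partial j (kconv mu (moll_kernel phi e) (fun y => mx_patch K u y 0 i)) x|
    <= Num.max M1 M2.
  by rewrite (le_trans (kM2 x))// le_max lexx orbT.
move=> /(_ H1 dE H2 H3); set I1 := (\int[mu]_x _)%E; set I2 := (\int[mu]_x _)%E => I12.
have -> : (\int[mu]_(x in B) (mollify phi u e x 0 i * partial j psi x)%:E)%E = I1.
  rewrite integral_mkcond; apply: eq_integral => x _; rewrite patchE.
  have [/set_mem Bx|xB] := boolP (x \in B); first by rewrite uE.
  rewrite (@partial_notin_supp _ _ psi) ?mulr0// => /suppB Bx.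
  by move: xB; rewrite notin_setE.
have -> : (\int[mu]_(x in B) (grad (mollify phi u e) x i j * psi x)%:E)%E = I2.
  rewrite integral_mkcond; apply: eq_integral => x _; rewrite patchE.
  have [/set_mem Bx|xB] := boolP (x \in B); first by rewrite DuE.
  rewrite psi0 ?mulr0// => /suppB Bx.
  by move: xB; rewrite notin_setE.
exact: I12.
Qed.

Hypothesis bB : bounded_set B.

Let Boo : (mu B < +oo)%E. Proof. exact: leb_bounded_lty. Qed.

(** Averaging an integrable map against a bounded kernel gives a bounded map, and [B] has finite
    measure. *)
Let Lp_kconv_mx p m l (W : 'rV[R]_n -> 'M[R]_(m, l)) (v : 'rV[R]_n -> 'M[R]_(m, l)) (e : R) :
  0 < p -> 0 < e -> (forall i j, L1 mu (fun y => W y i j)) ->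
  (forall x, B x -> v x = kconv_mx mu (moll_kernel phi e) W x) -> Lp p B v.
Proof.
move=> p0 e0 iW vW; have up := moll_kernel_unit kphi e0.
have ikW i j := (kconv_L1 up (iW i j)).1.
have /choice[M kM] : forall ij : 'I_m * 'I_l, exists M, forall x,
    `|kconv mu (moll_kernel phi e) (fun y => W y ij.1 ij.2) x| <= M.
  by move=> ij; exact: kconv_bounded.
refine (@Lp_bounded R n m l p B v (\sum_i \sum_j M (i, j)) p0 mB Boo _ _).
  move=> i j; apply: (eq_measurable_fun (kconv mu (moll_kernel phi e) (fun y => W y i j))).
    by move=> x /set_mem Bx; rewrite vW// mxE.
  exact: measurable_funTS (L1_measurable (ikW i j)).
move=> x Bx; rewrite (le_trans (enorm_le_sum _))// ler_sum// => i _; rewrite ler_sum// => j _.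
by rewrite vW// mxE; exact: (kM (i, j)).
Qed.

Lemma W1p_mollify p e : 0 < p -> 0 < e -> e <= d ->
  W1p p B (mollify phi u e) (grad (mollify phi u e)).
Proof.
move=> p0 e0 ed; split; first exact: weak_gradient_mollify.
- apply: (@Lp_kconv_mx _ _ _ (mx_patch K u) _ e) => //.
    by move=> i j; exact: L1_mx_patch_u uDu cK KOm i j.
  by move=> x Bx; exact: (mollify_kconv u kphi BK Bx e0 ed).
- apply: (@Lp_kconv_mx _ _ _ (mx_patch K Du) _ e) => //.
    by move=> i j; exact: L1_mx_patch_Du uDu cK KOm i j.
  by move=> x Bx; exact: (grad_mollify kphi uDu cK KOm BK oB Bx e0 ed).
Qed.

Lemma weak_gradientS : B `<=` K -> weak_gradient B u Du.
Proof.
move=> BK'; have [iu iDu tu] := uDu; have BOm : B `<=` Om by move=> x /BK'/KOm.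
split=> [i A cA AB|i j A cA AB|psi [spsi cpsi suppB] i j].
- by apply: iu => // x /AB/BOm.
- by apply: iDu => // x /AB/BOm.
have tpsi : test_function Om psi by split => // x /suppB/BOm.
have := tu psi tpsi i j.
have restrict (h k : 'rV[R]_n -> R) : (forall x, ~ supp psi x -> k x = 0) ->
    (\int[mu]_(x in Om) (h x * k x)%:E = \int[mu]_(x in B) (h x * k x)%:E)%E.
  move=> k0; rewrite integral_mkcond [RHS]integral_mkcond; apply: eq_integral => x _.
  rewrite !patchE; have [/set_mem Bx|xB] := boolP (x \in B).
    by rewrite mem_set//; exact: BOm.
  rewrite k0 ?mulr0 ?if_same// => /suppB Bx.
  by move: xB; rewrite notin_setE.
rewrite restrict; last by move=> x; exact: partial_notin_supp.
by rewrite restrict// => x; apply: contra_notP => /eqP px; exact: subset_closure.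
Qed.

End mollified_sobolev.

(** * The energy bound *)

(* This is where the bound on the gap [q - p] enters: the loss [e ^- n] of the
   pointwise bound on [A `^ p] is compensated by [e `^ sigma]. *)
Lemma powR_gap_absorb {R : realType} (n : nat) (p q sigma e A F C : R) :
  (0 < n)%N -> 0 < p -> p < q -> q <= p * (1 + sigma / n%:R) -> 0 < e -> e <= 1 ->
  0 <= A -> A `^ p <= F -> F <= e ^- n * C -> 0 <= C ->
  e `^ sigma * A `^ q <= C `^ ((q - p) / p) * F.
Proof.
(* The exponent is chosen so that [A ^ q = A ^ p * (A ^ p) ^ th]; (F1) then says exactly that
   [n * th <= sigma]. *)
move=> n0 p0 pq F1 e0 e1 A0 AF FC C0; set th := (q - p) / p.
have th0 : 0 < th by rewrite divr_gt0// subr_gt0.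
have F0 : 0 <= F by rewrite (le_trans _ AF)// powR_ge0.
have nR0 : 0 < n%:R :> R by rewrite ltr0n.
have nth : n%:R * th <= sigma.
  rewrite /th mulrA ler_pdivrMr//.
  have : q * n%:R <= p * (1 + sigma / n%:R) * n%:R by rewrite ler_pM2r.
  have -> : p * (1 + sigma / n%:R) * n%:R = p * n%:R + p * sigma by field; rewrite gt_eqF.
  lra.
have Aq : A `^ q = A `^ p * (A `^ p) `^ th.
  rewrite -powRrM -powRD; first by congr (_ `^ _); rewrite /th; field; rewrite gt_eqF.
  apply/implyP => /eqP h; exfalso.
  have : p + p * th = q by rewrite /th; field; rewrite gt_eqF.
  lra.
have en0 : 0 <= e ^- n by rewrite invr_ge0 exprn_ge0// ltW.
have Ath : (A `^ p) `^ th <= (e ^- n) `^ th * C `^ th.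
  rewrite -powRM//; apply: ge0_ler_powR.
  - exact: ltW.
  - by rewrite nnegrE powR_ge0.
  - by rewrite nnegrE mulr_ge0.
  - exact: le_trans AF FC.
have esig : e `^ sigma <= (e ^+ n) `^ th.
  rewrite -powR_mulrn ?(ltW e0)// -powRrM; apply: ger_powR => //.
  by rewrite e0.
have een : (e ^+ n) `^ th * (e ^- n) `^ th = 1.
  by rewrite -powRM ?exprn_ge0 ?(ltW e0)// divff ?powR1// gt_eqF// exprn_gt0.
rewrite Aq.
apply: (@le_trans _ _ ((e ^+ n) `^ th * (A `^ p * ((e ^- n) `^ th * C `^ th)))).
  by apply: ler_pM; rewrite ?powR_ge0 ?mulr_ge0 ?powR_ge0// ler_wpM2l// powR_ge0.
have -> : (e ^+ n) `^ th * (A `^ p * ((e ^- n) `^ th * C `^ th)) =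
   ((e ^+ n) `^ th * (e ^- n) `^ th) * (C `^ th * A `^ p) by ring.
by rewrite een mul1r ler_wpM2l// powR_ge0.
Qed.

Section energy.
Context {R : realType} {n N : nat}.
Local Notation mu := (leb R n).
Variables (Om K B : set 'rV[R]_n) (d : R) (phi : 'rV[R]_n -> R).
Variables (Du : 'rV[R]_n -> 'M[R]_(N, n)).
Variables (f : 'rV[R]_n -> 'M[R]_(N, n) -> R) (K1 K2 K3 sigma p q : R).
Hypothesis (n0 : (0 < n)%N).
Hypothesis (kphi : mollification_kernel phi).
Hypothesis (KOm : K `<=` Om).
Hypothesis (BK : forall x e, B x -> e <= d -> closure (eball x e) `<=` K).
Hypothesis (BsubK : B `<=` K).
Hypothesis (iDu : forall i j, L1 mu (fun y => mx_patch K Du y i j)).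
Hypothesis (hK1 : 1 <= K1) (hK2 : 0 <= K2) (hsigma : 0 < sigma).
Hypothesis (hp : 1 < p) (hpq : p < q) (F1 : q <= p * (1 + sigma / n%:R)).
Hypothesis F2 : forall x x' z, Om x -> Om x' ->
  enorm z `^ p <= f x z /\
  f x z <= K1 * f x' z + K2 * enorm (x - x') `^ sigma * enorm z `^ q + K3.
Hypothesis F3 : forall x, Om x -> convex_function setT (f x).
Hypothesis F4 : forall x e, Om x -> 0 < e -> closure (eball x e) `<=` Om ->
  exists2 y', closure (eball x e) y' &
    forall y z, closure (eball x e) y -> f y' z <= f y z.

Definition energy : 'rV[R]_n -> R := (fun y => f y (Du y)) \_ K.

Hypothesis iF : L1 mu energy.

Let p0 : 0 < p. Proof. by rewrite (lt_trans _ hp). Qed.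

(** The first bound dominates the convergence of the gradients, the second that of the energies. *)
Lemma mollified_energy_bound : exists2 C, 0 <= C & forall x e, B x -> 0 < e -> e <= d -> e <= 1 ->
  let z := kconv_mx mu (moll_kernel phi e) (mx_patch K Du) x in
  enorm z `^ p <= kconv mu (moll_kernel phi e) energy x /\
  `|f x z| <= C * kconv mu (moll_kernel phi e) energy x + K3.
Proof.
have [sphi supphi phi0 _ _] := kphi; have [cphi _] := sphi [::].
have [M phiM] := bounded_of_support cphi (fun t => @kernel_support_gt _ _ phi t supphi).
have M0 : 0 <= M by rewrite (le_trans _ (phiM 0)).
pose I := \int[mu]_y `|energy y|.
have I0 : 0 <= I by apply: Rintegral_ge0.
pose th := (q - p) / p.
(* [K1] and [K2] come from (F2). [M * I], the supremum of [phi] times the norm of the energy, bounds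
   [e ^ n] times the averaged energy, and its power [th] is the factor left by [powR_gap_absorb]. *)
exists (K1 + K2 * (M * I) `^ th).
  by rewrite addr_ge0 ?mulr_ge0 ?powR_ge0// (le_trans _ hK1).
move=> x e Bx e0 ed e1 z; set Fe := kconv _ _ _ _.
have up := moll_kernel_unit kphi e0.
have Omx : Om x by apply/KOm/BsubK.
have cK' := BK Bx ed.
have [y cy hy] := F4 Omx e0 (subset_trans cK' KOm).
have Omy : Om y by apply/KOm/cK'.
have en0 : 0 <= e ^- n by rewrite invr_ge0 exprn_ge0// ltW.
have fyF : f y z <= Fe.
  apply: jensen_kconv => //; first exact/convex_functionE/F3.
  move=> t kxt.
  have ct : closure (eball x e) t.
    apply: subset_closure; rewrite /eball/= ltNge; apply: contra kxt => ext.
    by rewrite moll_kernel_eq0// enormC.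
  have Kt := cK' _ ct.
  by rewrite mx_patchE// /energy patchE mem_set//; exact: hy.
have zy : enorm z `^ p <= f y z := (F2 z Omy Omy).1.
have zF := le_trans zy fyF.
have FeM : Fe <= e ^- n * (M * I).
  have kM t : `|moll_kernel phi e x t| <= e ^- n * M.
    by rewrite normrM (ger0_norm en0) ler_wpM2l// phiM.
  have mk : measurable_fun [set: lebType R n] (moll_kernel phi e x).
    exact/unit_kernel_measurable_r/up.
  have H : `|Fe| <= e ^- n * M * I := normr_Rintegral_mul_le iF mk kM.
  by rewrite mulrA (le_trans (ler_norm _)).
split=> //.
have [fx0 fxy] := F2 z Omx Omy.
rewrite ger0_norm; last by rewrite (le_trans _ fx0)// powR_ge0.
apply: (le_trans fxy); rewrite lerD2r mulrDl; apply: lerD.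
  by rewrite ler_wpM2l// (le_trans _ hK1).
rewrite -!mulrA ler_wpM2l//.
have gap := powR_gap_absorb n0 p0 hpq F1 e0 e1 (enorm_ge0 z) zF FeM (mulr_ge0 M0 I0).
apply: le_trans gap; rewrite ler_wpM2r ?powR_ge0//.
apply: ge0_ler_powR; rewrite ?nnegrE ?enorm_ge0 ?(ltW hsigma) ?(ltW e0)//.
by rewrite enormC; exact: closure_eball_le cy.
Qed.

Hypothesis (d0 : 0 < d).
Hypothesis (mB : measurable (B : set (lebType R n))) (Boo : (mu B < +oo)%E).
Hypothesis f_meas : forall z, measurable_fun (B : set (lebType R n)) (fun x => f x z).

Let K_unit (e : R) : 0 < e -> unit_kernel mu (moll_kernel phi e).
Proof. by move=> e0; exact: moll_kernel_unit. Qed.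

Let K_cvg (h : 'rV[R]_n -> R) : L1 mu h ->
  dist1 mu (kconv mu (moll_kernel phi e) h) h @[e --> 0^'+] --> 0%E.
Proof. exact: moll_cvg_L1. Qed.

(** The entries of [Du] (indices [Some ij]) give pointwise convergence through the continuity of
    [f x]; the energy (index [None]) gives the majorant. *)
Lemma mollified_energy_cvg :
  (\int[mu]_(x in B) (f x (kconv_mx mu (moll_kernel phi e) (mx_patch K Du) x))%:E)%E
    @[e --> 0^'+] --> (\int[mu]_(x in B) (f x (Du x))%:E)%E.
Proof.
have [C C0 HC] := mollified_energy_bound.
pose w (o : option ('I_N * 'I_n)) : 'rV[R]_n -> R :=
  if o is Some ij then (fun y => mx_patch K Du y ij.1 ij.2) else energy.
have iw o : L1 mu (w o) by case: o => [ij|] //=; exact: iDu.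
refine (@cvg_integral_kconv R _ (lebType R n) mu (moll_kernel phi) K_unit K_cvg _ w None B
  _ _ (fun=> K3) C iw _ mB _ _ C0 _ _).
- apply/integrableP; split; first by apply/measurable_EFinP; exact: measurable_cst.
  rewrite integral_cst// lte_mul_pinfty//.
- near=> e; have e0 : 0 < e by [].
  refine (@measurable_caratheodory_comp R _ (lebType R n) N n B mB
    (kconv_mx mu (moll_kernel phi e) (mx_patch K Du)) _ f f_meas _).
    exact: (kconv_mx_measurable K_unit e0 iDu mB).
  by move=> x Bx; apply/convexE_continuous/convex_functionE/F3/KOm/BsubK.
- have mF : measurable_fun (B : set (lebType R n)) energy.
    exact: measurable_funTS (L1_measurable iF).
  apply: eq_measurable_fun mF => x /set_mem Bx.
  by rewrite /energy patchE mem_set//; exact: BsubK.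
- near=> e => x Bx; have e0 : 0 < e by [].
  have ed : e <= d by near: e; exact: nbhs_right_le.
  have e1 : e <= 1 by near: e; exact: nbhs_right_le.
  have [_ h] := HC x e Bx e0 ed e1.
  by apply: (le_trans h); rewrite lerD2r ler_wpM2l// ler_norm.
- move=> s x s0 s_cvg Bx wx.
  have Omx : Om x by apply/KOm/BsubK.
  have zcvg : kconv_mx mu (moll_kernel phi (s k)) (mx_patch K Du) x @[k --> \oo] --> Du x.
    rewrite -(mx_patchE Du (BsubK Bx)); apply: mx_cvgP => i j.
    by under eq_cvg do rewrite mxE; exact: (wx (Some (i, j))).
  have cfx : continuous (f x) by apply/convexE_continuous/convex_functionE/F3.
  exact: (cvg_comp _ _ zcvg (cfx (Du x))).
Unshelve. all: by end_near. Qed.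

(** The energy dominates the [p]-th power of [Du] by the lower bound in (F2), and its averages
    dominate that of the averaged gradient, both with constant 1. *)
Lemma mollified_grad_cvg_Lp :
  (\int[mu]_(x in B) (enorm (kconv_mx mu (moll_kernel phi e) (mx_patch K Du) x -
    mx_patch K Du x) `^ p)%:E)%E @[e --> 0^'+] --> 0%E.
Proof.
have [C C0 HC] := mollified_energy_bound.
refine (@cvg_integral_enorm_powR R _ (lebType R n) mu (moll_kernel phi) K_unit K_cvg _ _
  (mx_patch K Du) energy B 1 p p0 ler01 iDu iF mB _ _).
- move=> x Bx; have Kx := BsubK Bx; rewrite mx_patchE// mul1r /energy patchE mem_set//.
  by have [] := F2 (Du x) (KOm Kx) (KOm Kx).
- near=> e => x Bx; rewrite mul1r; have e0 : 0 < e by [].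
  have ed : e <= d by near: e; exact: nbhs_right_le.
  have e1 : e <= 1 by near: e; exact: nbhs_right_le.
  by have [] := HC x e Bx e0 ed e1.
Unshelve. all: by end_near. Qed.

End energy.

Section sobolev_convergence.
Context {R : realType} {n m : nat}.
Local Notation mu := (leb R n).
Variables (K B : set 'rV[R]_n) (phi : 'rV[R]_n -> R) (u : 'rV[R]_n -> 'rV[R]_m) (p : R).
Hypothesis (kphi : mollification_kernel phi) (cK : compact K).
Hypothesis (mB : measurable (B : set (lebType R n))) (hp : 1 < p).
Hypothesis (iu : forall i j, L1 mu (fun y => mx_patch K u y i j)).
Hypothesis Lpu : Lp p K u.

Let p0 : 0 < p. Proof. by rewrite (lt_trans _ hp). Qed.

(** The majorant is a multiple of [sum_powR p] of the cut-off [u]: it is integrable because [u] is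
    in [L^p] on [K], and Jensen's inequality applies to it because it is convex. *)
Lemma mollified_cvg_Lp :
  (\int[mu]_(x in B) (enorm (kconv_mx mu (moll_kernel phi e) (mx_patch K u) x -
    mx_patch K u x) `^ p)%:E)%E @[e --> 0^'+] --> 0%E.
Proof.
have mK := leb_compact_measurable cK.
pose U := mx_patch K u.
pose G (ij : 'I_1 * 'I_m) y := `|U y ij.1 ij.2| `^ p.
have iE : L1 mu ((fun y => enorm (u y) `^ p) \_ K) by apply: L1_patch => //; exact: Lp_integrable.
have iG ij : L1 mu (G ij).
  refine (le_integrable measurableT _ _ iE).
    apply/measurable_EFinP/(measurableT_comp (measurable_powR p)).
    exact: (measurableT_comp (@normr_measurable R setT) (L1_measurable (iu ij.1 ij.2))).
  move=> y _; rewrite lee_fin /G /U mxE !patchE; case: ifP => yK.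
    rewrite /= !(ger0_norm (powR_ge0 _ _)).
    by rewrite ge0_ler_powR ?nnegrE ?(ltW p0) ?enorm_ge0// coord_le_enorm.
  by rewrite normr0 powR0 ?gt_eqF// normr0.
have iS : L1 mu (fun y => sum_powR p (U y)).
  have [h _] := Rintegral_sum (enum {: 'I_1 * 'I_m}) iG.
  by under eq_fun do rewrite /sum_powR -big_enum.
refine (@cvg_integral_enorm_powR R _ (lebType R n) mu (moll_kernel phi) _ _ _ _
  U _ B (#|{: 'I_1 * 'I_m}|%:R `^ p) p p0 (powR_ge0 _ _) iu iS mB _ _).
- by move=> e e0; exact: moll_kernel_unit.
- by move=> h ih; exact: moll_cvg_L1.
- by move=> x _; exact: enorm_powR_le_sum.
- near=> e => x _; have e0 : 0 < e by [].
  apply: (le_trans (enorm_powR_le_sum _ p0)); rewrite ler_wpM2l ?powR_ge0//.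
  apply: jensen_kconv => //; first exact: moll_kernel_unit.
  exact: sum_powR_convex (ltW hp).
Unshelve. all: by end_near. Qed.

End sobolev_convergence.

(** * Convergence of the mollifications in Sobolev norm and in energy *)

Unset Implicit Arguments.

Theorem theorem1p2 (R : realType) (n N : nat) (hn : (2 <= n)%N) (hN : (1 <= N)%N)
  (Omega : set 'rV[R]_n) (Omega_open : open Omega)
  (Omega_bounded : bounded_set Omega)
  (f : 'rV[R]_n -> 'M[R]_(N, n) -> R)
  (f_meas : forall z, measurable_fun (Omega : set (lebType R n)) (fun x => f x z))
  (K1 K2 K3 sigma p q : R)
  (hK1 : 1 <= K1) (hK2 : 0 <= K2) (hK3 : 0 <= K3) (hsigma : 0 < sigma)
  (hp : 1 < p) (hpq : p < q)
  (F1 : q <= p * (1 + sigma / n%:R))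
  (F2 : forall x x' z, Omega x -> Omega x' ->
     enorm z `^ p <= f x z /\
     f x z <= K1 * f x' z + K2 * enorm (x - x') `^ sigma * enorm z `^ q + K3)
  (F3 : forall x, Omega x -> convex_function setT (f x))
  (F4 : forall x e, Omega x -> 0 < e -> closure (eball x e) `<=` Omega ->
     exists2 y', closure (eball x e) y' &
       forall y z, closure (eball x e) y -> f y' z <= f y z)
  (phi : 'rV[R]_n -> R) (phi_kernel : mollification_kernel phi)
  (u : 'rV[R]_n -> 'rV[R]_N) (Du : 'rV[R]_n -> 'M[R]_(N, n))
  (u_W1p : W1p_loc p Omega u Du)
  (fDu_L1 : L1_loc Omega (fun x => f x (Du x)))
  (x0 : 'rV[R]_n) (rho : R) (rho_gt0 : 0 < rho)
  (B_sub : closure (eball x0 rho) `<=` Omega) :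
  let B := eball x0 rho in
  let u_ e := mollify phi u e in
  cvg_W1p p B u_ (fun e => grad (u_ e)) u Du /\
  (\int[leb R n]_(x in B) (f x (grad (u_ e) x))%:E)%E
    @[e --> 0^'+] --> (\int[leb R n]_(x in B) (f x (Du x))%:E)%E.
Proof.
move=> B u_; have [uDu Lpu LpDu] := u_W1p.
have p0 : 0 < p by rewrite (lt_trans _ hp).
have n0 : (0 < n)%N by rewrite (leq_trans _ hn).
(* Every local hypothesis on [u], [Du] and the energy is used on this one compact set. *)
have [K [d [cK KOm d0 cBK]]] :=
  eballs_in_compact Omega_open Omega_bounded (@closure_eball_compact _ _ x0 rho) B_sub.
have BK x e : B x -> e <= d -> closure (eball x e) `<=` K.
  by move=> Bx; apply: cBK; exact: subset_closure.
have BsubK : B `<=` K.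
  move=> x Bx; apply: (BK x d Bx (lexx d)); apply: subset_closure.
  by rewrite /eball/= subrr enorm0.
have oB : open B by exact: eball_open.
have mB : measurable (B : set (lebType R n)) by exact: leb_open_measurable.
have mK := leb_compact_measurable cK.
have bB : bounded_set B.
  case: Omega_bounded => [M [Mr hM]]; exists M; split=> // r rM y /BsubK/KOm; exact: hM.
have Boo := leb_bounded_lty bB.
have iU i j := L1_mx_patch_u uDu cK KOm i j.
have iDu i j := L1_mx_patch_Du uDu cK KOm i j.
have iF : L1 (leb R n) (energy K Du f) by apply: L1_patch => //; exact: fDu_L1.
have gradE e : 0 < e -> e <= d -> {in B, grad (u_ e) =1
    kconv_mx (leb R n) (moll_kernel phi e) (mx_patch K Du)}.
  move=> e0 ed x /set_mem Bx.
  exact: (grad_mollify phi_kernel uDu cK KOm BK oB Bx e0 ed).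
have near_d : \forall e \near (0 : R)^'+, 0 < e <= d.
  by near=> e; apply/andP; split => //; near: e; exact: nbhs_right_le.
have fB z : measurable_fun (B : set (lebType R n)) (fun x => f x z).
  apply: measurable_funS (f_meas z) => //; first exact: leb_open_measurable.
  by move=> x /BsubK/KOm.
split; last first.
  have := mollified_energy_cvg n0 phi_kernel KOm BK BsubK iDu hK1 hK2 hsigma hp hpq F1 F2 F3 F4
    iF d0 mB Boo fB.
  apply: cvg_trans; apply: near_eq_cvg; apply: filterS near_d => e /andP[e0 ed].
  by apply: eq_integral => x xB; rewrite gradE.
split.
- by apply: filterS near_d => e /andP[e0 ed]; exact: (W1p_mollify phi_kernel uDu cK KOm BK oB bB).
- split; first exact: (weak_gradientS uDu KOm BsubK).
  + exact: LpS p0 mB mK BsubK (Lpu K cK KOm).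
  + exact: LpS p0 mB mK BsubK (LpDu K cK KOm).
rewrite -[X in _ --> X](adde0 (0%E : \bar R)); apply: cvgeD => //.
- have := cvg_Lnorm_on p0 (mollified_cvg_Lp phi_kernel cK mB hp iU (Lpu K cK KOm)).
  apply: cvg_trans; apply: near_eq_cvg; apply: filterS near_d => e /andP[e0 ed].
  apply: eq_Lnorm_on => x /set_mem Bx.
  by rewrite (mx_patchE u (BsubK x Bx)) -(mollify_kconv u phi_kernel BK Bx e0 ed).
- have := cvg_Lnorm_on p0 (mollified_grad_cvg_Lp n0 phi_kernel KOm BK BsubK iDu hK1 hK2 hsigma hp hpq F1
    F2 F3 F4 iF d0 mB).
  apply: cvg_trans; apply: near_eq_cvg; apply: filterS near_d => e /andP[e0 ed].
  apply: eq_Lnorm_on => x xB.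
  by rewrite gradE// mx_patchE//; apply: BsubK; exact: set_mem.
Unshelve. all: by end_near. Qed.
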